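(* Let $(X,Y)$ be a pair of dependent random variables and let $d_X,d_Y$ be single-letter distortion measures. Assume that for every distortion pair $(D_1,D_2)$, every point $(R_0,R_1,R_2)\in\mathcal{R}_{GW}(D_1,D_2)$ lying on the Pangloss plane $R_0+R_1+R_2=R_{X,Y}(D_1,D_2)$ satisfies $R_0=I(X,Y;U)$, $R_1=I(X;\hat X|U)$, $R_2=I(Y;\hat Y|U)$ for some joint density $P(X,Y,U,\hat X,\hat Y)$ with $E(d_X(X,\hat X))\le D_1$ and $E(d_Y(Y,\hat Y))\le D_2$. Then for every distortion pair $(D_1,D_2)$, $$C_W(X,Y;D_1,D_2)=\inf I(X,Y;U),$$ where the infimum is over all joint densities $P(X,Y,\hat X,\hat Y,U)$ (with the given law of $(X,Y)$ and $U$ in an arbitrary alphabet) such that the Markov conditions $$\hat X\leftrightarrow U\leftrightarrow \hat Y,\qquad (X,Y)\leftrightarrow(\hat X,\hat Y)\leftrightarrow U$$ hold and $P(\hat X,\hat Y|X,Y)\in\mathcal{P}^{X,Y}_{D_1,D_2}$.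
   Context: Setting. $X,Y$ take values in alphabets $\mathcal X,\mathcal Y$, with reconstruction alphabets $\hat{\mathcal X},\hat{\mathcal Y}$ and single-letter distortion measures $d_X$ on $\mathcal X\times\hat{\mathcal X}$, $d_Y$ on $\mathcal Y\times\hat{\mathcal Y}$. ''Joint density'' means joint probability mass function in the discrete case. $A\leftrightarrow B\leftrightarrow C$ means that $A,B,C$ form a Markov chain in that order. Rate distortion function. $R_{X,Y}(D_1,D_2)=\inf I(X,Y;\hat X,\hat Y)$ over all conditional distributions $P(\hat X,\hat Y|X,Y)$ with $E(d_X(X,\hat X))\le D_1$ and $E(d_Y(Y,\hat Y))\le D_2$. $\mathcal P^{X,Y}_{D_1,D_2}$ is the set of all $P(\hat X,\hat Y|X,Y)$ satisfying these two distortion constraints and $I(X,Y;\hat X,\hat Y)=R_{X,Y}(D_1,D_2)$. Gray-Wyner region. Let $(X^n,Y^n)$ be $n$ i.i.d. copies of $(X,Y)$ and $I_M=\{1,\dots,M\}$. A tuple $(R_0,R_1,R_2,D_1,D_2)$ is achievable if for all $\epsilon>0$ there exist $n$, $M_0,M_1,M_2$ and maps $f_E:\mathcal X^n\times\mathcal Y^n\to I_{M_0}\times I_{M_1}\times I_{M_2}$, $f_D^{(X)}:I_{M_0}\times I_{M_1}\to\hat{\mathcal X}^n$, $f_D^{(Y)}:I_{M_0}\times I_{M_2}\to\hat{\mathcal Y}^n$ such that $M_i\le 2^{n(R_i+\epsilon)}$ for $i=0,1,2$, and, with $(S_0,S_1,S_2)=f_E(X^n,Y^n)$, $\hat X^n=f_D^{(X)}(S_0,S_1)$,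 $\hat Y^n=f_D^{(Y)}(S_0,S_2)$, one has $E\big[\frac1n\sum_i d_X(X_i,\hat X_i)\big]\le D_1+\epsilon$ and $E\big[\frac1n\sum_i d_Y(Y_i,\hat Y_i)\big]\le D_2+\epsilon$. The achievable region is the convex closure of the set of achievable tuples, and $\mathcal R_{GW}(D_1,D_2)$ is the set of $(R_0,R_1,R_2)$ such that $(R_0,R_1,R_2,D_1,D_2)$ is in this region. Known characterization (Gray and Wyner): the region is the closure of the set of all tuples satisfying $R_0\ge I(X,Y;U)$, $R_1\ge I(X;\hat X|U)$, $R_2\ge I(Y;\hat Y|U)$, $D_1\ge E(d_X(X,\hat X))$, $D_2\ge E(d_Y(Y,\hat Y))$ for some random variables $(U,\hat X,\hat Y)$ jointly distributed with $(X,Y)$, with $U$ in an arbitrary alphabet. Lossy Wyner common information. $\mathcal R_W(D_1,D_2)$ is the set of all $R_0$ such that for any $\epsilon>0$ there is a point $(R_0,R_1,R_2)\in\mathcal R_{GW}(D_1,D_2)$ with $R_0+R_1+R_2\le R_{X,Y}(D_1,D_2)+\epsilon$; and $C_W(X,Y;D_1,D_2)=\inf\{R_0: R_0\in\mathcal R_W(D_1,D_2)\}$.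
   Formalization: The conclusion is stated for distortion pairs with R_{X,Y}(D_1,D_2) finite, i.e. where the Pangloss plane exists; when it is infinite the formula can fail (e.g. X=(W,A), Y=(W,B), independent W,A,B with H(A)=H(B)=∞, Hamming distortion, D=(0,0)). *)

(* Defs.v *)
From HB Require Import structures.
From mathcomp Require Import all_boot all_order all_algebra.
From mathcomp Require Import all_classical all_reals all_analysis.
From mathcomp Require Import measurable_realfun.

Set Implicit Arguments.
Unset Strict Implicit.
Unset Printing Implicit Defensive.

Import Order.TTheory GRing.Theory Num.Theory.
Import numFieldNormedType.Exports.

Local Open Scope classical_set_scope.
Local Open Scope ring_scope.
Local Open Scope charge_scope.
Local Open Scope ereal_scope.

Section projections.
Context d1 d2 (T1 : measurableType d1) (T2 : measurableType d2).

HB.instance Definition _ :=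
  isMeasurableFun.Build _ _ (T1 * T2)%type T1 fst measurable_fst.
HB.instance Definition _ :=
  isMeasurableFun.Build _ _ (T1 * T2)%type T2 snd measurable_snd.

End projections.

Section pairing.
Context d d1 d2 (T : measurableType d) (T1 : measurableType d1)
  (T2 : measurableType d2).

Definition rv_pair (f : {mfun T >-> T1}) (g : {mfun T >-> T2}) : T -> T1 * T2 :=
  fun w => (f w, g w).

Let measurable_rv_pair f g : measurable_fun [set: T] (rv_pair f g).
Proof. exact: measurable_fun_pair. Qed.

HB.instance Definition _ f g := isMeasurableFun.Build _ _ T (T1 * T2)%type
  (rv_pair f g) (measurable_rv_pair f g).

End pairing.

Section information_measures.
Context {R : realType}.

(* All information quantities are in bits, as required by the rate constraints
   [M_i <= 2 ^ (n (R_i + eps))]. *)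
Definition log2 (x : R) : R := (ln x / ln 2)%R.

Definition relative_entropy {d} {T : measurableType d}
    (P Q : probability T R) : \bar R :=
  if `[< P `<< Q >] then
    \int[P]_x (log2 (fine (('d (charge_of_finite_measure P) '/d Q) x)))%:E
  else +oo.

Context d (T : measurableType d) (P : probability T R).

Definition mutual_info {d1 d2} {A : measurableType d1} {B : measurableType d2}
    (f : {RV P >-> A}) (g : {RV P >-> B}) : \bar R :=
  relative_entropy (distribution P (rv_pair f g))
    (distribution P f \x distribution P g).

(* [k] is a regular conditional distribution of [g] given [f]. *)
Definition cond_distribution {d1 d2} {A : measurableType d1}
    {B : measurableType d2} (f : {RV P >-> A}) (g : {RV P >-> B})
    (k : R.-pker A ~> B) : Prop :=
  forall (E : set A) (F : set B), measurable E -> measurable F ->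
    P (f @^-1` E `&` g @^-1` F) = \int[P]_(w in f @^-1` E) k (f w) F.

(* [I(f; g | h) = D(P_{fgh} || P_{f|h} P_{g|h} P_h)].  The value does not depend
   on the versions of the conditional distributions, so the set below has at
   most one element; the infimum only turns the definition into a total
   function, with value [+oo] when [f] or [g] admits no regular conditional
   distribution given [h] (which cannot happen on discrete or standard Borel
   alphabets, nor in the presence of a joint density). *)
Definition cond_mutual_info {d1 d2 d3} {A : measurableType d1}
    {B : measurableType d2} {C : measurableType d3}
    (f : {RV P >-> A}) (g : {RV P >-> B}) (h : {RV P >-> C}) : \bar R :=
  ereal_inf [set v | exists (kf : R.-pker C ~> A) (kg : R.-pker C ~> B)
                            (Q : probability (A * B * C)%type R),
    [/\ cond_distribution h f kf, cond_distribution h g kg,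
        (forall (E : set A) (F : set B) (G : set C),
           measurable E -> measurable F -> measurable G ->
           Q (E `*` F `*` G) =
             \int[P]_(w in h @^-1` G) (kf (h w) E * kg (h w) F)) &
        v = relative_entropy (distribution P (rv_pair (rv_pair f g) h)) Q]].

(* [f <-> g <-> h]: for every event [E], the conditional probability of
   [h \in E] given [(f, g)] has a version that is a function of [g]. *)
Definition markov_chain {d1 d2 d3} {A : measurableType d1}
    {B : measurableType d2} {C : measurableType d3}
    (f : {RV P >-> A}) (g : {RV P >-> B}) (h : {RV P >-> C}) : Prop :=
  forall E : set C, measurable E ->
    exists phi : B -> \bar R,
      [/\ measurable_fun [set: B] phi, (forall b, 0 <= phi b) &
          forall (F : set A) (G : set B), measurable F -> measurable G ->
            P (f @^-1` F `&` g @^-1` G `&` h @^-1` E) =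
              \int[P]_(w in f @^-1` F `&` g @^-1` G) phi (g w)].

End information_measures.

(* Smallest closed convex superset. *)
Definition convex_closure {R : realType} {V : normedModType R} (S : set V) :
    set V :=
  \bigcap_(C in [set C : set V | [/\ closed C, convex_set C & S `<=` C]]) C.

(* Tuples [(R0, R1, R2, D1, D2)], as a normed module over [R]. *)
Notation rd_tuple R := (R^o * R^o * R^o * R^o * R^o)%type.

Section joint_variables.
Context {R : realType}.
Context {dx dy du dxh dyh : measure_display}.
Context {X : measurableType dx} {Y : measurableType dy}.
Context {U : measurableType du}.
Context {Xh : measurableType dxh} {Yh : measurableType dyh}.
Variable P : probability (X * Y * U * Xh * Yh)%type R.

Definition rvX : {RV P >-> X} := fst \o (fst \o (fst \o fst)).
Definition rvY : {RV P >-> Y} := snd \o (fst \o (fst \o fst)).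
Definition rvU : {RV P >-> U} := snd \o (fst \o fst).
Definition rvXh : {RV P >-> Xh} := snd \o fst.
Definition rvYh : {RV P >-> Yh} := snd.
Definition rvXY : {RV P >-> (X * Y)%type} := rv_pair rvX rvY.
Definition rvXhYh : {RV P >-> (Xh * Yh)%type} := rv_pair rvXh rvYh.

(* The reference measures are not fixed: on countable alphabets this is a joint
   probability mass function (counting measures), on Euclidean ones a density in
   the usual sense, and mixed cases are allowed. *)
Definition has_joint_density : Prop :=
  exists (mX : {sigma_finite_measure set X -> \bar R})
         (mY : {sigma_finite_measure set Y -> \bar R})
         (mU : {sigma_finite_measure set U -> \bar R})
         (mXh : {sigma_finite_measure set Xh -> \bar R})
         (mYh : {sigma_finite_measure set Yh -> \bar R})
         (p : X * Y * U * Xh * Yh -> \bar R),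
    [/\ measurable_fun setT p, (forall w, 0 <= p w) &
        forall E, measurable E ->
          P E = \int[mX \x mY \x mU \x mXh \x mYh]_(w in E) p w].

Definition extends_source (PXY : probability (X * Y)%type R) : Prop :=
  forall E, measurable E -> distribution P rvXY E = PXY E.

Definition distortions_le (dX : X * Xh -> R) (dY : Y * Yh -> R) (D1 D2 : R) :=
  'E_P[fun w => dX (rvX w, rvXh w)] <= D1%:E /\
  'E_P[fun w => dY (rvY w, rvYh w)] <= D2%:E.

End joint_variables.

Section source.
Context {R : realType}.
Context {dx dy dxh dyh : measure_display}.
Context {X : measurableType dx} {Y : measurableType dy}.
Context {Xh : measurableType dxh} {Yh : measurableType dyh}.
Variable PXY : probability (X * Y)%type R.

Definition dependent : Prop :=
  ~ (forall (A : set X) (B : set Y), measurable A -> measurable B ->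
       PXY (A `*` B) = PXY (A `*` setT) * PXY (setT `*` B)).

Variables (dX : X * Xh -> R) (dY : Y * Yh -> R).

Section rate_distortion.

(* [J] is the joint law of [((X, Y), (Xh, Yh))] when [(X, Y)] has law [PXY] and
   [k] is the conditional distribution P(Xh, Yh | X, Y); it always exists and
   is unique. *)
Definition channel_law (k : R.-pker (X * Y) ~> (Xh * Yh)%type)
    (J : probability ((X * Y) * (Xh * Yh))%type R) : Prop :=
  (forall E, measurable E -> distribution J fst E = PXY E) /\
  cond_distribution (fst : {RV J >-> (X * Y)%type})
                    (snd : {RV J >-> (Xh * Yh)%type}) k.

Definition channel_info (J : probability ((X * Y) * (Xh * Yh))%type R) :=
  mutual_info (fst : {RV J >-> (X * Y)%type}) (snd : {RV J >-> (Xh * Yh)%type}).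

Definition meets_distortions (D1 D2 : R)
    (J : probability ((X * Y) * (Xh * Yh))%type R) : Prop :=
  'E_J[fun w => dX (w.1.1, w.2.1)] <= D1%:E /\
  'E_J[fun w => dY (w.1.2, w.2.2)] <= D2%:E.

Definition rate_distortion (D1 D2 : R) : \bar R :=
  ereal_inf [set v | exists (k : R.-pker (X * Y) ~> (Xh * Yh)%type) J,
    [/\ channel_law k J, meets_distortions D1 D2 J & v = channel_info J]].

Definition optimal_channels (D1 D2 : R) : set (R.-pker (X * Y) ~> (Xh * Yh)%type) :=
  [set k | exists J, [/\ channel_law k J, meets_distortions D1 D2 J &
                         channel_info J = rate_distortion D1 D2]].

End rate_distortion.

Section gray_wyner.

(* The law of [n] i.i.d. copies of [(X, Y)] (determined by its values on
   measurable boxes). *)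
Definition iid_law (n : nat) (Q : probability (n.-tuple (X * Y)) R) : Prop :=
  forall A : 'I_n -> set (X * Y), (forall i, measurable (A i)) ->
    Q [set w | forall i, A i (tnth w i)] = \prod_(i < n) PXY (A i).

Definition achievable (t : rd_tuple R) : Prop :=
  let: (R0, R1, R2, D1, D2) := t in
  forall eps : R, (0 < eps)%R ->
  exists (n M0 M1 M2 : nat)
         (fE : n.-tuple X * n.-tuple Y -> 'I_M0 * 'I_M1 * 'I_M2)
         (fX : 'I_M0 * 'I_M1 -> n.-tuple Xh)
         (fY : 'I_M0 * 'I_M2 -> n.-tuple Yh)
         (Q : probability (n.-tuple (X * Y)) R),
    let S w := fE (map_tuple fst w, map_tuple snd w) in
    [/\ (0 < n)%N, iid_law Q & forall s, measurable (fE @^-1` [set s])] /\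
    [/\ (M0%:R <= 2 `^ (n%:R * (R0 + eps)))%R,
        (M1%:R <= 2 `^ (n%:R * (R1 + eps)))%R &
        (M2%:R <= 2 `^ (n%:R * (R2 + eps)))%R] /\
    'E_Q[fun w => (n%:R^-1 * \sum_(i < n)
           dX ((tnth w i).1, tnth (fX (S w).1) i))%R]
      <= (D1 + eps)%:E /\
    'E_Q[fun w => (n%:R^-1 * \sum_(i < n)
           dY ((tnth w i).2, tnth (fY ((S w).1.1, (S w).2)) i))%R]
      <= (D2 + eps)%:E.

Definition achievable_region := convex_closure [set t | achievable t].

Definition gray_wyner_region (D1 D2 : R) : set (R * R * R) :=
  [set r | achievable_region (r.1.1, r.1.2, r.2, D1, D2)].

(* Here [(U, Xh, Yh)] ranges over all random variables jointly distributed with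
   [(X, Y)], with or without a joint density. *)
Definition single_letter_tuples : set (rd_tuple R) :=
  [set t | let: (R0, R1, R2, D1, D2) := t in
    exists (du : measure_display) (U : measurableType du)
           (P : probability (X * Y * U * Xh * Yh)%type R),
      [/\ extends_source P PXY, distortions_le P dX dY D1 D2,
          mutual_info (rvXY P) (rvU P) <= R0%:E,
          cond_mutual_info (rvX P) (rvXh P) (rvU P) <= R1%:E &
          cond_mutual_info (rvY P) (rvYh P) (rvU P) <= R2%:E]].

(* The Gray-Wyner coding theorem for this source and these distortion measures.
   It holds on finite alphabets, and on general ones under the usual
   integrability conditions on the distortions, but not for every source with
   unbounded distortion on infinite alphabets. *)
Definition gray_wyner_characterization : Prop :=
  achievable_region = closure single_letter_tuples.

End gray_wyner.

Section common_information.

Definition common_info_rates (D1 D2 : R) : set R :=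
  [set R0 | forall eps : R, (0 < eps)%R -> exists R1 R2 : R,
     gray_wyner_region D1 D2 (R0, R1, R2) /\
     (R0 + R1 + R2)%:E <= rate_distortion D1 D2 + eps%:E].

(* [+oo] when no rate qualifies. *)
Definition lossy_common_info (D1 D2 : R) : \bar R :=
  ereal_inf [set R0%:E | R0 in common_info_rates D1 D2].

(* The Pangloss plane is [R0 + R1 + R2 = rate_distortion D1 D2]; the equation
   forces the rate-distortion function to be finite. *)
Definition pangloss_representable : Prop :=
  forall D1 D2 R0 R1 R2 : R,
    gray_wyner_region D1 D2 (R0, R1, R2) ->
    (R0 + R1 + R2)%:E = rate_distortion D1 D2 ->
  exists (du : measure_display) (U : measurableType du)
         (P : probability (X * Y * U * Xh * Yh)%type R),
    [/\ extends_source P PXY, has_joint_density P & distortions_le P dX dY D1 D2] /\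
    [/\ R0%:E = mutual_info (rvXY P) (rvU P),
        R1%:E = cond_mutual_info (rvX P) (rvXh P) (rvU P) &
        R2%:E = cond_mutual_info (rvY P) (rvYh P) (rvU P)].

Definition markov_informations (D1 D2 : R) : set (\bar R) :=
  [set v | exists (du : measure_display) (U : measurableType du)
                  (P : probability (X * Y * U * Xh * Yh)%type R),
    [/\ extends_source P PXY, has_joint_density P,
        markov_chain (rvXh P) (rvU P) (rvYh P),
        markov_chain (rvXY P) (rvXhYh P) (rvU P) &
        exists2 k, optimal_channels D1 D2 k &
                   cond_distribution (rvXY P) (rvXhYh P) k] /\
    v = mutual_info (rvXY P) (rvU P)].

End common_information.

End source.

(* Main.v *)
(* Take the marginals of a joint density P as reference measures: P is dominated
   by mu = P(X,Y) x P(U) x P(Xh) x P(Yh).  Let G be the density ratio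
   dP(X,Y,U)/d(P(X,Y)P(U)) * P(Xh|X,U)/P(Xh|U) * P(Yh|Y,U)/P(Yh|U) and
   g = P(X,Y|Xh,Yh)/P(X,Y).  Then log G and log g integrate to
   I(X,Y;U) + I(X;Xh|U) + I(Y;Yh|U) and I(X,Y;Xh,Yh), so comparing the two sides
   amounts to a single use of Gibbs' inequality.
   If both Markov conditions hold, then P = g P(Xh|U) P(Yh|U) . mu, the integral
   of G/g under P is at most 1, and the sum of the rates is at most the
   rate-distortion function.
   Conversely, replacing P by P' = P(X,Y,U) P(Xh|X,U) P(Yh|Y,U) changes neither
   the three rates nor the distortions; now the integral of g/G under P' is at
   most 1, so the sum is at least I(X,Y;Xh,Yh), hence at least the
   rate-distortion function.  On the Pangloss plane equality holds, so G = g
   almost surely, P' = g P(Xh|U) P(Yh|U) . mu, and both Markov conditions follow.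
   A rate R0 that is only approximately on the plane is moved onto it because the
   region is closed, upward closed in R2, and has R1, R2 >= 0. *)
Require Import Defs.
From HB Require Import structures.
From mathcomp Require Import all_boot all_order all_algebra.
From mathcomp Require Import all_classical all_reals all_analysis.
From mathcomp Require Import measurable_realfun.
From mathcomp Require Import ring lra.

Set Implicit Arguments.
Unset Strict Implicit.
Unset Printing Implicit Defensive.

Import Order.TTheory GRing.Theory Num.Theory.
Import numFieldNormedType.Exports.

Local Open Scope classical_set_scope.
Local Open Scope ring_scope.
Local Open Scope ereal_scope.

(** * Densities and uniqueness of laws *)

(** The alphabets are arbitrary measurable spaces, where regular conditional distributions may fail
    to exist: all of them are extracted from the joint density, against the marginals of P. Each
    density is made to integrate to 1 at every value of the conditioning variable, because new laws
    are assembled from these factors and may charge values that P does not. The two bounds by 1 are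
    one cancellation. G P(Xh|U) P(Yh|U) is the density of P' and g P(Xh|U) P(Yh|U) is that of a
    second probability law, so G/g times the second is the first and g/G times the first is the
    second. Where a factor vanishes, the convention 1/0 = 0 turns the cancellation into an
    inequality in the direction needed. Informations may be infinite, so logarithms are never
    assumed integrable. Only their negative parts are shown to be, which suffices to add and compare
    integrals; the equality case asks for a finite sum. Equality puts P' below the second law on
    every event, and two probability laws so ordered coincide. *)

Section density.
Context d (T : measurableType d) (R : realType).
Variables (mu : {sigma_finite_measure set T -> \bar R}).
Variables (p : T -> \bar R) (mp : measurable_fun setT p) (p0 : forall x, 0 <= p x).

(** Change of variables holds for the Radon-Nikodym derivative, and [p] equals that derivative
    almost everywhere because both have integral [nu E] over every measurable [E]. *)
Let ge0_integral_density_fin (nu : {finite_measure set T -> \bar R})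
    (nup : forall E, measurable E -> nu E = \int[mu]_(x in E) p x)
    (E : set T) (f : T -> \bar R) :
  measurable E -> measurable_fun E f -> (forall x, 0 <= f x) ->
  \int[nu]_(x in E) f x = \int[mu]_(x in E) (f x * p x).
Proof.
move=> mE mf f0.
have numu : nu `<< mu.
  apply/null_content_dominatesP => A mA A0; rewrite nup//.
  by rewrite null_set_integral//; exact: measurable_funTS.
have ip : mu.-integrable setT p.
  apply/integrableP; split => //.
  under eq_integral do rewrite gee0_abs//.
  by rewrite -nup// ltey_eq fin_num_measure.
rewrite -(Radon_Nikodym_SigmaFinite.change_of_variables numu f0 mE mf).
apply: ae_eq_integral => //.
- apply: emeasurable_funM => //; apply: measurable_funTS.
  exact: measurable_int (Radon_Nikodym_SigmaFinite.f_integrable numu).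
- by apply: emeasurable_funM => //; exact: measurable_funTS.
apply: ae_eqe_mul2l; apply: (@ae_eq_subset _ _ _ _ _ setT) => //.
apply: integral_ae_eq => //.
  exact: Radon_Nikodym_SigmaFinite.f_integrable.
by move=> F _ mF; rewrite -nup// -Radon_Nikodym_SigmaFinite.f_integral.
Qed.

Lemma ge0_integral_density (nu : {measure set T -> \bar R}) :
    nu setT < +oo ->
    (forall E, measurable E -> nu E = \int[mu]_(x in E) p x) ->
  forall (E : set T) (f : T -> \bar R), measurable E -> measurable_fun E f ->
    (forall x, 0 <= f x) ->
  \int[nu]_(x in E) f x = \int[mu]_(x in E) (f x * p x).
Proof.
(* Restriction to the whole space gives [nu] the structure of a finite measure without changing its
   values. *)
move=> nuoo nup E f mE mf f0; pose nu' := mfrestr measurableT nuoo.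
have nu'E F : nu' F = nu F by rewrite /nu'/= /mfrestr /mrestr setIT.
rewrite -(@ge0_integral_density_fin nu')//; last first.
  by move=> F mF; rewrite -nup// -nu'E.
by apply: eq_measure_integral => F mF _; rewrite -nu'E.
Qed.

Hypothesis p1 : \int[mu]_x p x = 1.

Definition density_measure (E : set T) := \int[mu]_(x in E) p x.

Let density_measure0 : density_measure set0 = 0.
Proof. exact: integral_set0. Qed.

Let density_measure_ge0 E : 0 <= density_measure E.
Proof. exact: integral_ge0. Qed.

Let density_measure_sigma_additive : semi_sigma_additive density_measure.
Proof.
move=> F mF tF mUF; rewrite /density_measure.
rewrite ge0_integral_bigcup//; last exact: measurable_funTS.
apply: is_cvg_ereal_nneg_natsum_cond => n _ _.
exact: integral_ge0.
Qed.

HB.instance Definition _ := isMeasure.Build _ _ _ density_measure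
  density_measure0 density_measure_ge0 density_measure_sigma_additive.

HB.instance Definition _ := Measure_isProbability.Build _ _ _ density_measure p1.

Lemma density_probability : exists P : probability T R,
  forall E, measurable E -> P E = \int[mu]_(x in E) p x.
Proof. by exists density_measure. Qed.

End density.

Section box_uniqueness.
Context d1 d2 (A : measurableType d1) (B : measurableType d2) (R : realType).

(** Boxes form a pi-system that generates the product sigma-algebra and contains the whole space, so
    they determine a finite measure. *)
Lemma box2_unique (m1 m2 : {measure set (A * B) -> \bar R}) :
  m1 setT < +oo ->
  (forall E F, measurable E -> measurable F -> m1 (E `*` F) = m2 (E `*` F)) ->
  forall E, measurable E -> m1 E = m2 E.
Proof.
move=> m1oo m12.
pose G : set (set (A * B)) :=
  [set C | exists E, measurable E /\ exists F, measurable F /\ C = E `*` F].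
apply: (measure_unique G (fun _ => setT)).
- rewrite measurable_prod_measurableType //; congr (<<s _ >>).
  rewrite predeqE; split => [[E mE [F mF <-]]|[E [mE [F [mF ->]]]]].
    by exists E; split => //; exists F.
  by exists E => //; exists F.
- move=> /= _ _ [X1 [mX1 [X2 [mX2 ->]]]] [Y1 [mY1 [Y2 [mY2 ->]]]].
  rewrite -setXI; exists (X1 `&` Y1); split; first exact: measurableI.
  by exists (X2 `&` Y2); split => //; exact: measurableI.
- by move=> n; exists setT; split => //; exists setT; split => //; rewrite setXTT.
- by rewrite bigcup_const.
- by move=> _ [E [mE [F [mF ->]]]]; exact: m12.
- by [].
Qed.
End box_uniqueness.

Section box_uniqueness34.
Context d1 d2 d3 (A : measurableType d1) (B : measurableType d2)
  (C : measurableType d3) (R : realType).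

Let slice_measure (m : {measure set (A * B) -> \bar R}) (F : set B) :
  measurable F -> exists m' : {measure set A -> \bar R},
    forall E, measurable E -> m' E = m (E `*` F).
Proof.
move=> mF.
have mF' : measurable ((setT : set A) `*` F) by exact: measurableX.
unshelve eexists (pushforward (mrestr m mF') (@fst A B)).
  exact: measurable_fst.
move=> E mE; rewrite /= /pushforward/= /mrestr; congr (m _).
by apply/seteqP; split => -[x y] /=; tauto.
Qed.

(** Induction step for products of several factors: fixing the last side [F] of a box leaves a
    finite measure on the other factors, where uniqueness for fewer factors applies. *)
Lemma box_unique_slice (m1 m2 : {measure set (A * B) -> \bar R}) :
  m1 setT < +oo ->
  (forall (n1 n2 : {measure set A -> \bar R}) F, measurable F ->
    n1 setT < +oo ->
    (forall E, measurable E -> n1 E = m1 (E `*` F)) ->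
    (forall E, measurable E -> n2 E = m2 (E `*` F)) ->
    forall E, measurable E -> n1 E = n2 E) ->
  forall E, measurable E -> m1 E = m2 E.
Proof.
move=> m1oo h; apply: box2_unique => // E F mE mF.
have [n1 n1E] := slice_measure m1 mF; have [n2 n2E] := slice_measure m2 mF.
rewrite -n1E// -n2E//; apply: (h _ _ F) => //.
by rewrite n1E// (le_lt_trans _ m1oo)// le_measure// ?inE//; exact: measurableX.
Qed.

End box_uniqueness34.

Lemma box3_unique d1 d2 d3 (A : measurableType d1) (B : measurableType d2)
    (C : measurableType d3) (R : realType)
    (m1 m2 : {measure set (A * B * C) -> \bar R}) :
  m1 setT < +oo ->
  (forall E F G, measurable E -> measurable F -> measurable G ->
     m1 (E `*` F `*` G) = m2 (E `*` F `*` G)) ->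
  forall E, measurable E -> m1 E = m2 E.
Proof.
move=> m1oo m12; apply: box_unique_slice => // n1 n2 G mG n1oo n1E n2E.
apply: box2_unique => // E F mE mF.
by rewrite n1E ?n2E ?m12//; exact: measurableX.
Qed.

Lemma box4_unique d1 d2 d3 d4 (A : measurableType d1) (B : measurableType d2)
    (C : measurableType d3) (D : measurableType d4) (R : realType)
    (m1 m2 : {measure set (A * B * C * D) -> \bar R}) :
  m1 setT < +oo ->
  (forall E F G H, measurable E -> measurable F -> measurable G -> measurable H ->
     m1 (E `*` F `*` G `*` H) = m2 (E `*` F `*` G `*` H)) ->
  forall E, measurable E -> m1 E = m2 E.
Proof.
move=> m1oo m12; apply: box_unique_slice => // n1 n2 H mH n1oo n1E n2E.
apply: box3_unique => // E F G mE mF mG.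
by rewrite n1E ?n2E ?m12//; apply: measurableX => //; exact: measurableX.
Qed.

(** * Absolute continuity *)

Section absolute_continuity.
Context d1 d2 (A : measurableType d1) (B : measurableType d2) (R : realType).

(** A partial converse of domination. [Z] is the zero set of the density of [n]; off [Z] the density
    is positive, so a set of [n]-measure 0 carries no [m]-mass there. *)
Lemma dominates_complement d0 (A0 : measurableType d0)
    (m : {sigma_finite_measure set A0 -> \bar R})
    (n : {finite_measure set A0 -> \bar R}) : n `<< m ->
  exists Z, [/\ measurable Z, n Z = 0 &
    forall E, measurable E -> n E = 0 -> m (E `\` Z) = 0].
Proof.
move=> nm; pose r := Radon_Nikodym_SigmaFinite.f n m.
have mr : measurable_fun setT r.
  exact: measurable_int (Radon_Nikodym_SigmaFinite.f_integrable nm).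
have mZ : measurable (r @^-1` [set 0]) by rewrite -[X in measurable X]setTI; exact: mr.
exists (r @^-1` [set 0]); split => //.
  by rewrite (Radon_Nikodym_SigmaFinite.f_integral nm)// integral0_eq.
move=> E mE; rewrite (Radon_Nikodym_SigmaFinite.f_integral nm)// => E0.
have : \int[m]_(x in E) `|r x| = 0.
  rewrite -E0; apply: eq_integral => x _; rewrite gee0_abs//.
  exact: Radon_Nikodym_SigmaFinite.f_ge0.
move/(ae_eq_integral_abs _ mE (measurable_funTS mr)) => [N [mN N0 EN]].
apply: (subset_measure0 (measurableD mE mZ) mN _ N0).
by apply: subset_trans EN => x/= [Ex rx] /(_ Ex).
Qed.

Lemma measurable_xsection_neq0 (m : {sigma_finite_measure set B -> \bar R})
    (N : set (A * B)) : measurable N -> measurable [set x | m (xsection N x) != 0].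
Proof.
move=> mN; rewrite (_ : [set _ | _] = (m \o xsection N) @^-1` (~` [set 0])).
  rewrite -[X in measurable X]setTI; apply: (measurable_fun_xsection m mN) => //.
  exact: measurableC.
by apply/seteqP; split => x /= /eqP.
Qed.

Lemma product_measure_null (m1 : {measure set A -> \bar R})
    (m2 : {sigma_finite_measure set B -> \bar R}) N : measurable N ->
  (m1 \x m2) N = 0 <-> m1 [set x | m2 (xsection N x) != 0] = 0.
Proof.
move=> mN; rewrite /product_measure1.
have mf : measurable_fun setT (m2 \o xsection N) by exact: measurable_fun_xsection.
have mS := measurable_xsection_neq0 m2 mN.
have <- : \int[m1]_x `|(m2 \o xsection N) x| = \int[m1]_x (m2 \o xsection N) x.
  by apply: eq_integral => x _; rewrite gee0_abs.
split.
- move/(ae_eq_integral_abs m1 measurableT mf) => [M [mM M0 SM]].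
  apply: (subset_measure0 mS mM _ M0).
  by apply: subset_trans SM => x/= /eqP ? /(_ I).
- move=> S0; apply/(ae_eq_integral_abs m1 measurableT mf).
  by exists [set x | m2 (xsection N x) != 0]; split => // x/= /not_implyP[_ /eqP].
Qed.

Lemma product_dominates (m1 n1 : {measure set A -> \bar R})
    (m2 n2 : {sigma_finite_measure set B -> \bar R}) :
  n1 `<< m1 -> n2 `<< m2 -> n1 \x n2 `<< m1 \x m2.
Proof.
move=> /null_content_dominatesP nm1 /null_content_dominatesP nm2.
apply/null_content_dominatesP => N mN /(product_measure_null _ _ mN) N0.
apply/(product_measure_null _ _ mN).
have mS m := measurable_xsection_neq0 m mN.
apply: (subset_measure0 (mS n2) (mS m2)); last exact: nm1.
move=> x/=; apply: contra_neq => /nm2; apply.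
exact: measurable_xsection.
Qed.

(** By [dominates_complement], a null set of [n1 \x n2] becomes null for [m1 \x m2], hence for [J],
    once the strips over [Z1] and [Z2] are cut off. The strips have [J]-measure 0 because [n1] and
    [n2] are the marginals of [J]. *)
Lemma dominates_marginals (m1 : {sigma_finite_measure set A -> \bar R})
    (m2 : {sigma_finite_measure set B -> \bar R})
    (J : {finite_measure set (A * B)%type -> \bar R})
    (n1 : {finite_measure set A -> \bar R})
    (n2 : {finite_measure set B -> \bar R}) :
  (forall E, measurable E -> J (E `*` setT) = n1 E) ->
  (forall F, measurable F -> J (setT `*` F) = n2 F) ->
  J `<< m1 \x m2 -> J `<< n1 \x n2.
Proof.
move=> Jn1 Jn2 /null_content_dominatesP Jm.
have nm1 : n1 `<< m1.
  apply/null_content_dominatesP => E mE E0.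
  rewrite -Jn1//; apply: Jm; first exact: measurableX.
  by rewrite [LHS]product_measure1E// E0 mul0e.
have nm2 : n2 `<< m2.
  apply/null_content_dominatesP => E mE E0.
  rewrite -Jn2//; apply: Jm; first exact: measurableX.
  by rewrite [LHS]product_measure1E// E0 mule0.
have [Z1 [mZ1 Z10 hZ1]] := dominates_complement nm1.
have [Z2 [mZ2 Z20 hZ2]] := dominates_complement nm2.
apply/null_content_dominatesP => N mN /(product_measure_null _ _ mN) N0.
pose N' := N `&` (~` Z1 `*` ~` Z2).
have mN' : measurable N'.
  by apply: measurableI => //; apply: measurableX; exact: measurableC.
have : J N' = 0.
  apply: Jm => //; apply/(product_measure_null _ _ mN').
  have mS := measurable_xsection_neq0 n2 mN.
  apply: (subset_measure0 _ _ _ (hZ1 _ mS N0)).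
  - exact: measurable_xsection_neq0.
  - exact: measurableD.
  move=> x/= N'x; have Z1x : ~ Z1 x.
    move=> Z1x; move/eqP: N'x; apply; rewrite (_ : xsection _ _ = set0) ?measure0//.
    by rewrite -subset0 => y; rewrite /xsection/= inE => -[_ []].
  split=> //; apply: contra_neq N'x => N0x.
  apply: (subset_measure0 _ _ _ (hZ2 _ _ N0x)); [exact: measurable_xsection|..].
  - by apply: measurableD => //; exact: measurable_xsection.
  - by move=> y; rewrite /xsection/= !inE => -[? []].
  - exact: measurable_xsection.
move=> JN'0; apply/eqP; rewrite -measure_le0.
have mX1 : measurable (Z1 `*` (setT : set B)) by exact: measurableX.
have mX2 : measurable ((setT : set A) `*` Z2) by exact: measurableX.
apply: (@le_trans _ _ (J (N' `|` (Z1 `*` setT `|` setT `*` Z2)))).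
  apply: le_measure; rewrite ?inE//; first by do 2!apply: measurableU => //.
  move=> [x y] Nxy; have [Z1x|Z1x] := pselect (Z1 x); first by right; left.
  by have [Z2y|Z2y] := pselect (Z2 y); [right; right|left].
rewrite (le_trans (measureU2 _ _ _))//; first exact: measurableU.
rewrite [X in X + _]JN'0 add0e (le_trans (measureU2 _ _ _))//.
by rewrite [X in X + _]Jn1// [X in _ + X]Jn2// Z10 Z20 adde0.
Qed.

End absolute_continuity.

(** * Conditional densities *)

(** Sections of the Radon-Nikodym derivative integrate to 1 only for almost every [s]; the
    exceptional sections are replaced by the constant density 1. *)
Lemma kernel_density_exists d1 d2 (S : measurableType d1)
    (T : measurableType d2) (R : realType) (m1 : probability S R)
    (m2 : probability T R) (J : probability (S * T)%type R) :
  (forall E, measurable E -> J (E `*` setT) = m1 E) ->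
  J `<< m1 \x m2 ->
  exists k : S * T -> R, [/\ measurable_fun setT k, (forall z, (0 <= k z)%R),
    (forall s, \int[m2]_t (k (s, t))%:E = 1) &
    forall E, measurable E -> J E = \int[m1 \x m2]_(z in E) (k z)%:E].
Proof.
move=> Jm1 Jm.
pose m12 : probability (S * T)%type R := (m1 \x m2 : probability _ R).
pose r := Radon_Nikodym_SigmaFinite.f J m12.
have r0 z : 0 <= r z by exact: Radon_Nikodym_SigmaFinite.f_ge0.
have rfin z : r z \is a fin_num by exact: Radon_Nikodym_SigmaFinite.f_fin_num.
have mr : measurable_fun setT r.
  exact: measurable_int (@Radon_Nikodym_SigmaFinite.f_integrable _ _ _ J m12 Jm).
pose n s := \int[m2]_t r (s, t).
have mn : measurable_fun setT n by exact: measurable_fun_fubini_tonelli_F.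
have n0 s : 0 <= n s by exact: integral_ge0.
have En E : measurable E -> \int[m1]_(s in E) n s = m1 E.
  move=> mE; rewrite -Jm1//.
  rewrite (@Radon_Nikodym_SigmaFinite.f_integral _ _ _ J m12 Jm); last exact: measurableX.
  rewrite integral_mkcond [RHS]integral_mkcond fubini_tonelli1//; last 2 first.
  - apply/(measurable_restrictT _ _).1; first exact: measurableX.
    exact: measurable_funTS.
  - by move=> z; rewrite patchE; case: ifP.
  apply: eq_integral => s _; rewrite patchE /fubini_F; case: ifPn => sE.
    by apply: eq_integral => t _; rewrite patchE in_setX sE in_setT.
  by rewrite integral0_eq// => t _; rewrite patchE in_setX (negPf sE).
have n1 : m1 (~` [set s | n s = 1]) = 0.
  have : ae_eq m1 setT (cst 1) n.
    apply: integral_ae_eq => //; first exact: finite_measure_integrable_cst.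
    by move=> E _ mE; rewrite En// integral_cst// mul1e.
  move=> [N [mN N0 sN]].
  have mn1 : measurable (~` [set s | n s = 1]).
    apply: measurableC; rewrite (_ : [set _ | _] = n @^-1` [set 1])//.
    by rewrite -[X in measurable X]setTI; exact: mn.
  apply: (subset_measure0 mn1 mN _ N0).
  by apply: subset_trans sN => s/= ns1 /(_ I) /esym.
have mn1 : measurable [set s | n s = 1].
  rewrite (_ : [set _ | _] = n @^-1` [set 1])//.
  by rewrite -[X in measurable X]setTI; exact: mn.
pose V := [set s | n s = 1].
pose k (z : S * T) : R := if z.1 \in V then fine (r z) else 1%R.
have mk : measurable_fun setT k.
  apply: measurable_fun_ifT => //.
    apply: (measurable_fun_bool true).
    rewrite (_ : _ @^-1` [set true] = fst @^-1` V).
      by apply: measurable_fst.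
    by apply/seteqP; split => z /=; [exact: set_mem|exact: mem_set].
  exact: measurableT_comp.
have k0 z : (0 <= k z)%R by rewrite /k; case: ifP => // _; exact: fine_ge0.
exists k; split => //.
  move=> s; rewrite /k/=; have [sV|sV] := boolP (s \in V).
    have := sV; rewrite inE /V/= => <-; apply: eq_integral => t _; rewrite fineK//.
  by rewrite integral_cst// mul1e; exact: probability_setT.
move=> E mE; rewrite (@Radon_Nikodym_SigmaFinite.f_integral _ _ _ J m12 Jm)//.
apply: ae_eq_integral => //; first exact: measurable_funTS.
  by apply: measurable_funTS; exact: measurableT_comp.
exists (~` [set s | n s = 1] `*` setT); split.
- by apply: measurableX => //; exact: measurableC.
- by rewrite [LHS]product_measure1E//; [rewrite [X in X * _]n1 mul0e|exact: measurableC].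
- move=> [s t] /= /not_implyP[_]; rewrite /k/= => h; split => // ns1; apply: h.
  by rewrite mem_set// fineK.
Qed.

Section conditional_density.
Context d ds dt (W : measurableType d) (S : measurableType ds)
  (T : measurableType dt) (R : realType).

(* [k (s, t)] is the density at [t], with respect to the law of [g], of a regular
   conditional distribution of [g] given [f = s]; the normalization is required
   for every [s], not only almost everywhere, so that [k] can be integrated
   against laws of [f] other than the one under [P]. *)
Definition conditional_density (P : probability W R) (f : {mfun W >-> S})
    (g : {mfun W >-> T}) (k : S * T -> R) : Prop :=
  [/\ measurable_fun setT k, (forall z, (0 <= k z)%R),
      (forall s, \int[distribution P g]_t (k (s, t))%:E = 1) &
      forall E, measurable E -> distribution P (rv_pair f g) E =
        \int[distribution P f \x distribution P g]_(z in E) (k z)%:E].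

Variables (P : probability W R) (f : {mfun W >-> S}) (g : {mfun W >-> T}).


Lemma conditional_density_exists :
  distribution P (rv_pair f g) `<< distribution P f \x distribution P g ->
  exists k, conditional_density P f g k.
Proof.
move=> Jm; apply: kernel_density_exists => // E mE.
by rewrite /distribution /pushforward; congr (P _); apply/seteqP; split => w //= [].
Qed.

End conditional_density.

Section kernel_of_probability.
Context d1 d2 (S : measurableType d1) (T : measurableType d2) (R : realType).
Variable k : S -> probability T R.
Hypothesis mk : forall F, measurable F -> measurable_fun [set: S] (fun s => k s F).

Let kernel_of_probability (s : S) : {measure set T -> \bar R} := k s.

HB.instance Definition _ :=
  isKernel.Build _ _ S T R kernel_of_probability mk.

Let kernel_of_probability_setT s : kernel_of_probability s setT = 1.
Proof. exact: probability_setT. Qed.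

HB.instance Definition _ := Kernel_isProbability.Build _ _ S T R
  kernel_of_probability kernel_of_probability_setT.

Lemma probability_kernel_exists : exists k' : R.-pker S ~> T,
  forall s F, k' s F = k s F.
Proof. by exists kernel_of_probability. Qed.

End kernel_of_probability.

Lemma in_preimage (S T : Type) (f : S -> T) (E : set T) (w : S) :
  (w \in f @^-1` E) = (f w \in E).
Proof. by apply/idP/idP => /set_mem h; exact/mem_set. Qed.

Section conditional_density_theory.
Context d ds dt (W : measurableType d) (S : measurableType ds)
  (T : measurableType dt) (R : realType).
Variables (P : probability W R) (f : {mfun W >-> S}) (g : {mfun W >-> T}).
Variables (k : S * T -> R) (fgk : conditional_density P f g k).

Let mk : measurable_fun setT k. Proof. by case: fgk. Qed.
Let k0 z : (0 <= k z)%R. Proof. by case: fgk. Qed.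
Let mkE : measurable_fun setT (EFin \o k). Proof. exact/measurable_EFinP. Qed.

Lemma conditional_density_integral (h : S * T -> \bar R) :
  measurable_fun setT h -> (forall z, 0 <= h z) ->
  \int[P]_w h (f w, g w) =
  \int[P]_w \int[distribution P g]_t (h (f w, t) * (k (f w, t))%:E).
Proof.
move=> mh h0; have [_ _ _ fgE] := fgk.
rewrite -(ge0_integral_distribution (rv_pair f g : {RV P >-> _}) mh h0).
pose m12 : probability (S * T)%type R :=
  (distribution P f \x distribution P g : probability _ R).
have -> : \int[distribution P (rv_pair f g)]_y h y =
    \int[m12]_z (h z * (k z)%:E).
  by apply: (@ge0_integral_density _ _ _ m12 (EFin \o k)) => //; by rewrite [X in X < _]probability_setT ltry.
rewrite fubini_tonelli1/=; last 2 first.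
- exact: emeasurable_funM.
- by move=> z; rewrite mule_ge0// lee_fin.
rewrite (ge0_integral_distribution (f : {RV P >-> _}))//.
- apply: measurable_fun_fubini_tonelli_F; first exact: emeasurable_funM.
  by move=> z; rewrite mule_ge0// lee_fin.
- by move=> s; apply: integral_ge0 => t _; rewrite mule_ge0// lee_fin.
Qed.

(** The zero set of a density is not charged by the law that it defines; this makes quotients and
    logarithms of densities legitimate under [P]. *)
Lemma conditional_density_gt0 : {ae P, forall w, (0 < k (f w, g w))%R}.
Proof.
have [_ _ _ fgE] := fgk; pose N := k @^-1` [set 0%R].
have mN : measurable N by rewrite -[X in measurable X]setTI; exact: mk.
exists (rv_pair f g @^-1` N); split.
- by rewrite -[X in measurable X]setTI; apply: measurable_funP.
- rewrite -[LHS]/(distribution P (rv_pair f g) N) fgE// integral0_eq// => z.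
  by rewrite /N/= => ->.
- by move=> w/= /negP; rewrite -leNgt => kw; apply/eqP; rewrite eq_le kw k0.
Qed.

(** Normalization at every [s] makes each section of [k] a probability density, so the kernel has no
    exceptional set; its measurability in [s] comes from Tonelli's theorem. *)
Lemma conditional_density_kernel : exists k' : R.-pker S ~> T,
  (forall s F, measurable F ->
     k' s F = \int[distribution P g]_(t in F) (k (s, t))%:E) /\
  cond_distribution (f : {RV P >-> S}) (g : {RV P >-> T}) k'.
Proof.
have [_ _ k1 fgE] := fgk.
have mks s : measurable_fun setT (fun t => (k (s, t))%:E)
  by exact: (measurableT_comp mkE (measurable_pair1 s)).
have /choice[q qE] : forall s, exists q : probability T R, forall F, measurable F ->
    q F = \int[distribution P g]_(t in F) (k (s, t))%:E.
  by move=> s; apply: density_probability => // t; rewrite lee_fin.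
have mq F : measurable F -> measurable_fun setT (fun s => q s F).
  move=> mF; under eq_fun do rewrite qE//.
  under eq_fun do rewrite integral_mkcond.
  apply: (measurable_fun_fubini_tonelli_F (fun z => ((fun t => (k (z.1, t))%:E) \_ F) z.2)).
    rewrite (_ : (fun _ => _) = (EFin \o k) \_ (setT `*` F)).
      by apply/(measurable_restrictT _ _).1; [exact: measurableX|exact: measurable_funTS].
    by apply/funext => -[s t]; rewrite !patchE/= in_setX in_setT.
  by move=> z; apply: erestrict_ge0 => t _; rewrite lee_fin.
have [k' k'E] := probability_kernel_exists mq.
exists k'; split=> [s F mF|E F mE mF]; first by rewrite k'E qE.
pose h := (cst 1%E : S * T -> \bar R) \_ (E `*` F).
have mh : measurable_fun setT h.
  by apply/(measurable_restrictT _ _).1; [exact: measurableX|exact: measurable_cst].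
have -> : P (f @^-1` E `&` g @^-1` F) = \int[P]_w h (f w, g w).
  rewrite -[LHS]mul1e -integral_cst; last first.
    by apply: measurableI; rewrite -[X in measurable X]setTI; apply: measurable_funP.
  rewrite integral_mkcond; apply: eq_integral => w _.
  by rewrite /h !patchE/= in_setX in_setI !in_preimage.
rewrite conditional_density_integral//; last first.
  by move=> z; apply: erestrict_ge0.
rewrite [RHS]integral_mkcond; apply: eq_integral => w _.
rewrite patchE in_preimage; have [wE|wE] := boolP (f w \in E).
  rewrite k'E qE// [RHS]integral_mkcond; apply: eq_integral => t _.
  by rewrite /h !patchE/= in_setX wE/=; case: ifP; rewrite ?mul1e ?mul0e.
by rewrite integral0_eq// => t _; rewrite /h patchE in_setX/= (negPf wE) mul0e.
Qed.

End conditional_density_theory.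

(** * Gibbs' inequality *)

Lemma measurable_invr (R : realType) : measurable_fun [set: R] (@GRing.inv R).
Proof.
(* The square covers negative [x], and at 0 the factor [x] reproduces the convention that the
   inverse of 0 is 0. *)
have -> : @GRing.inv R = (fun x => x * expR (- ln (x ^+ 2)))%R.
  apply/funext => x; have [->|x0] := eqVneq x 0%R; first by rewrite invr0 mul0r.
  rewrite expRN lnK ?posrE ?exprn_even_gt0// expr2 invfM mulrA divff// mul1r//.
apply: measurable_funM => //; apply: measurableT_comp => //.
apply: measurable_funN; apply: measurableT_comp => //.
Qed.

Lemma measurable_log2 (R : realType) : measurable_fun [set: R] (@log2 R).
Proof. by apply: measurable_funM => //. Qed.

Lemma log2M (R : realType) (x y : R) : (0 < x)%R -> (0 < y)%R ->
  log2 (x * y)%R = (log2 x + log2 y)%R.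
Proof. by move=> x0 y0; rewrite /log2 lnM ?posrE// mulrDl. Qed.

Section integral_real.
Context d (T : measurableType d) (R : realType) (P : {measure set T -> \bar R}).
Implicit Types f g : T -> R.

(** When this is finite, the integral of [f] is meaningful in (-oo, +oo], which is where integrals
    of logarithms are added. *)
Definition neg_int f := \int[P]_x (Num.max (- f x) 0)%:E.

Lemma integral_posneg f : \int[P]_x (f x)%:E =
  \int[P]_x (Num.max (f x) 0)%:E - neg_int f.
Proof.
rewrite integralE /neg_int; congr (_ - _); apply: eq_integral => x _.
  by rewrite funeposE -EFin_max.
by rewrite funenegE EFin_max.
Qed.

Let maxr_posneg (r : R) : Num.max r 0%R = (r + Num.max (- r) 0)%R.
Proof.
have [r0|r0] := leP r 0%R.
  by rewrite (max_idPl _) ?oppr_ge0// subrr.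
by rewrite (max_idPr _) ?addr0// oppr_le0 ltW.
Qed.

Lemma integralD_neg f g : measurable_fun setT f -> measurable_fun setT g ->
  neg_int f < +oo -> neg_int g < +oo ->
  neg_int (fun x => f x + g x)%R < +oo /\
  \int[P]_x (f x + g x)%:E = \int[P]_x (f x)%:E + \int[P]_x (g x)%:E.
Proof.
move=> mf mg; rewrite [\int[P]_x (f x + g x)%:E]integral_posneg.
rewrite [\int[P]_x (f x)%:E]integral_posneg [\int[P]_x (g x)%:E]integral_posneg /neg_int.
have mfg : measurable_fun setT (fun x => f x + g x)%R by exact: measurable_funD.
have mp (h : T -> R) : measurable_fun setT h -> measurable_fun setT (fun x => (Num.max (h x) 0)%:E : \bar R).
  by move=> mh; apply/measurable_EFinP; exact: measurable_maxr.
have mn (h : T -> R) : measurable_fun setT h -> measurable_fun setT (fun x => (Num.max (- h x) 0)%:E : \bar R).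
  by move=> mh; apply: (mp (fun x => - h x)%R); exact: measurable_funN.
have m0 (r : R) : 0 <= (Num.max r 0)%:E by rewrite lee_fin le_max lexx orbT.
set b1 := \int[P]_x (Num.max (- f x) 0)%:E.
set b2 := \int[P]_x (Num.max (- g x) 0)%:E.
set b := \int[P]_x (Num.max (- (f x + g x)) 0)%:E.
set a := \int[P]_x (Num.max (f x + g x) 0)%:E.
set a1 := \int[P]_x (Num.max (f x) 0)%:E.
set a2 := \int[P]_x (Num.max (g x) 0)%:E => b1oo b2oo.
have bb : b <= b1 + b2.
  rewrite -ge0_integralD//; [|exact: mn..].
  apply: ge0_le_integral => //; first exact: mn.
  - by apply: emeasurable_funD; exact: mn.
  move=> x _; rewrite -EFinD lee_fin ge_max opprD lerD ?le_max ?lexx//=.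
  by rewrite addr_ge0// le_max lexx orbT.
have boo : b < +oo by rewrite (le_lt_trans bb)// lte_add_pinfty.
split=> //.
(* Integrated form of (f+g)^+ + f^- + g^- = f^+ + g^+ + (f+g)^-. The integrals of negative parts are
   finite, so they can be subtracted even when the positive ones are infinite. *)
have : a + (b1 + b2) = a1 + a2 + b.
  rewrite -!ge0_integralD//; try by [exact: mp|exact: mn|
    apply: emeasurable_funD; exact: mp|apply: emeasurable_funD; exact: mn|
    move=> x _; rewrite adde_ge0].
  apply: eq_integral => x _; rewrite -!EFinD; congr EFin.
  by rewrite (maxr_posneg (f x)) (maxr_posneg (g x)) (maxr_posneg (f x + g x)%R); ring.
have : 0 <= a by exact: integral_ge0.
have : 0 <= a1 by exact: integral_ge0.
have : 0 <= a2 by exact: integral_ge0.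
have : 0 <= b1 by exact: integral_ge0.
have : 0 <= b2 by exact: integral_ge0.
have : 0 <= b by exact: integral_ge0.
move: a a1 a2 b b1 b2 b1oo b2oo boo {bb} => [a||] [a1||] [a2||] [b||] [b1||] [b2||] //= _ _ _ _ _ _ _ _ _.
by rewrite -!EFinD => -[h]; congr EFin; lra.
Qed.

Lemma ge0_neg_int f : (forall x, (0 <= f x)%R) -> neg_int f = 0.
Proof.
move=> f0; rewrite /neg_int integral0_eq// => x _.
by congr EFin; apply/max_idPr; rewrite oppr_le0.
Qed.

End integral_real.

Section gibbs.
Context d (T : measurableType d) (R : realType) (P : probability T R).
Variable g : T -> R.
Hypotheses (mg : measurable_fun setT g) (g0 : forall x, (0 <= g x)%R).
Hypothesis g_gt0 : {ae P, forall x, (0 < g x)%R}.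
Hypothesis gV1 : \int[P]_x (g x)^-1%:E <= 1.

(* [log2 g = c (1 - 1/g) + h] with [h >= 0] vanishing only where [g = 1]. *)
Lemma gibbs :
  [/\ neg_int P (log2 \o g) < +oo, 0 <= \int[P]_x (log2 (g x))%:E &
      \int[P]_x (log2 (g x))%:E = 0 -> {ae P, forall x, g x = 1%R}].
Proof.
pose c : R := (ln 2)^-1%R.
have c0 : (0 < c)%R by rewrite invr_gt0 ln_gt0// ltr1n.
have mgV : measurable_fun setT (fun x => (g x)^-1)%R.
  by apply: (measurableT_comp (@measurable_invr R)).
have mlg : measurable_fun setT (fun x => log2 (g x)).
  by apply: (measurableT_comp (@measurable_log2 R)).
(* This is ln(1 + t) <= t at t = 1/x - 1; the factor [c] converts to bits. *)
have log2_ge x : (0 < x)%R -> (c * (1 - x^-1) <= log2 x)%R.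
  move=> x0; rewrite /log2 mulrC ler_pM2r// -lerN2 opprB -lnV ?posrE//.
  have := @le_ln1Dx R (x^-1 - 1)%R; rewrite (_ : 1 + (x^-1 - 1) = x^-1)%R; last by ring.
  by apply; rewrite ltrBDr addNr invr_gt0.
(* Strictness of exp(t) > 1 + t at t = - ln x, unless t = 0. *)
have log2_eq x : (0 < x)%R -> log2 x = (c * (1 - x^-1))%R -> x = 1%R.
  move=> x0 /eqP; rewrite /log2 mulrC (inj_eq (mulfI _)); last by rewrite gt_eqF.
  move=> /eqP e.
  have [//|x1] := eqVneq x 1%R.
  have /expR_gt1Dx : (- ln x != 0)%R by rewrite oppr_eq0 ln_eq0.
  by rewrite expRN lnK ?posrE// e subKr ltxx.
pose f1 x := (c * (1 - (g x)^-1))%R.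
(* The bound [log2_ge] holds only where [g] is positive; the maximum makes [h] nonnegative
   everywhere and alters the difference only on a null set. *)
pose h x := (Num.max (log2 (g x) - f1 x) 0)%R.
have mf1 : measurable_fun setT f1.
  by apply: measurable_funM => //; exact: measurable_funB.
have mh : measurable_fun setT h.
  by apply: measurable_maxr => //; exact: measurable_funB.
have h0 x : (0 <= h x)%R by rewrite le_max lexx orbT.
have hE : ae_eq P setT (fun x => (log2 (g x))%:E) (fun x => (f1 x + h x)%:E).
  apply: filterS g_gt0 => x gx _; congr EFin.
  by rewrite /h (max_idPl _) ?subr_ge0 ?log2_ge// addrC subrK.
have igV : P.-integrable setT (fun x => (g x)^-1%:E).
  apply/integrableP; split; first exact/measurable_EFinP.
  under eq_integral do rewrite gee0_abs ?lee_fin ?invr_ge0//.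
  by rewrite (le_lt_trans gV1)// ltry.
have ic : P.-integrable setT (fun x => c%:E) by exact: finite_measure_integrable_cst.
have f1E : \int[P]_x (f1 x)%:E = c%:E * (1 - \int[P]_x (g x)^-1%:E).
  rewrite /f1; under eq_integral do rewrite EFinM EFinB.
  rewrite integralZl//; last first.
    apply: (@integrableB _ _ _ P setT measurableT (cst 1)) => //.
    exact: finite_measure_integrable_cst.
  rewrite integralB//; last exact: (finite_measure_integrable_cst _ 1%R).
  by rewrite integral_cst// mul1e [X in _ * (X - _)]probability_setT.
have f10 : 0 <= \int[P]_x (f1 x)%:E.
  rewrite f1E; apply: mule_ge0; first by rewrite lee_fin ltW.
  by rewrite subre_ge0.
have nf1 : neg_int P f1 < +oo.
  apply: (@le_lt_trans _ _ (\int[P]_x (c%:E * (g x)^-1%:E))).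
    apply: ge0_le_integral => //.
    - by move=> x _; rewrite lee_fin le_max lexx orbT.
    - by apply/measurable_EFinP; apply: measurable_maxr => //; exact: measurable_funN.
    - by apply/measurable_EFinP; exact: measurable_funM.
    move=> x _; rewrite -EFinM lee_fin ge_max; apply/andP; split.
      by rewrite /f1 -mulrN opprB ler_pM2l// gerBl.
    by apply: mulr_ge0; [exact: ltW|rewrite invr_ge0].
  rewrite ge0_integralZl_EFin//; last 3 first.
  - by move=> x _; rewrite lee_fin invr_ge0.
  - exact/measurable_EFinP.
  - exact: ltW.
  by rewrite (le_lt_trans (lee_wpmul2l _ gV1)) ?lee_fin ?(ltW c0)// mule1 ltry.
have nh : neg_int P h < +oo by rewrite ge0_neg_int.
have [nfh fhE] := integralD_neg mf1 mh nf1 nh.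
have intE : \int[P]_x (log2 (g x))%:E = \int[P]_x (f1 x)%:E + \int[P]_x (h x)%:E.
  by rewrite -fhE; apply: ae_eq_integral => //; apply/measurable_EFinP => //; exact: measurable_funD.
have inth0 : 0 <= \int[P]_x (h x)%:E by apply: integral_ge0 => x _; rewrite lee_fin.
split.
- rewrite (_ : neg_int P _ = neg_int P (fun x => f1 x + h x)%R)//.
  apply: ae_eq_integral => //.
  + by apply/measurable_EFinP; apply: measurable_maxr => //; exact: measurable_funN.
  + apply/measurable_EFinP; apply: measurable_maxr => //; apply: measurable_funN.
    exact: measurable_funD.
  + by apply: filterS hE => x hx _; have [e] := hx I; rewrite /= e.
- by rewrite intE adde_ge0.
(* Both integrals are nonnegative, the first by [gV1], so a zero sum forces [h] to vanish almost
   everywhere and [log2_eq] applies. *)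
- rewrite intE => /eqP; rewrite padde_eq0// => /andP[_ /eqP ih0].
  have : \int[P]_x `|(h x)%:E| = 0.
    by rewrite -ih0; apply: eq_integral => x _; rewrite gee0_abs// lee_fin.
  move=> /(ae_eq_integral_abs _ measurableT) ah.
  have {}ah := ah ((measurable_EFinP _ _).2 mh).
  apply: filterS2 g_gt0 ah => x gx /(_ I)[hx]; apply: log2_eq => //.
  apply/eqP; rewrite eq_le log2_ge// andbT -subr_le0 -hx /h le_max lexx//.
Qed.

End gibbs.

(** * Information quantities through densities *)

Section restricted_law.
Context d d2 (W : measurableType d) (B : measurableType d2) (R : realType).
Variables (P : probability W R) (g : {mfun W >-> B}).

Lemma measurable_preimage_mfun (E : set B) : measurable E -> measurable (g @^-1` E).
Proof. by move=> mE; rewrite -[X in measurable X]setTI; exact: measurable_funP. Qed.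

Lemma integral_distribution_real (F : B -> R) : measurable_fun setT F ->
  \int[distribution P g]_x (F x)%:E = \int[P]_w (F (g w))%:E /\
  neg_int (distribution P g) F = neg_int P (F \o g).
Proof.
move=> mF; have mp (h : B -> R) : measurable_fun setT h ->
    \int[distribution P g]_x (Num.max (h x) 0)%:E =
    \int[P]_w (Num.max (h (g w)) 0)%:E.
  move=> mh; rewrite (ge0_integral_distribution (g : {RV P >-> _}))//.
    by apply/measurable_EFinP; exact: measurable_maxr.
  by move=> y; rewrite lee_fin le_max lexx orbT.
have nE : neg_int (distribution P g) F = neg_int P (F \o g).
  by rewrite /neg_int (mp (fun x => - F x)%R)//; exact: measurable_funN.
by split=> //; rewrite integral_posneg nE mp// [RHS]integral_posneg.
Qed.

(** The hypothesis says that p(g) is the conditional probability of [D] given [g], or that the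
    measure G -> P(D, g in G) has density [p] with respect to the law of [g]. This extends the
    identity from indicators to all [psi]. *)
Lemma integral_restricted_law (D : set W) (p : B -> \bar R) :
  measurable D -> measurable_fun setT p -> (forall b, 0 <= p b) ->
  (forall G, measurable G -> P (D `&` g @^-1` G) = \int[P]_(w in g @^-1` G) p (g w)) ->
  forall psi : B -> \bar R, measurable_fun setT psi -> (forall b, 0 <= psi b) ->
  \int[P]_(w in D) psi (g w) = \int[P]_w (psi (g w) * p (g w)).
Proof.
move=> mD mp p0 DE psi mpsi psi0.
have mpsig : measurable_fun setT (psi \o g) by exact: measurableT_comp.
pose m := mrestr P mD.
transitivity (\int[m]_w psi (g w)).
  transitivity (\int[m]_(w in D) psi (g w)).
    apply: eq_measure_integral => A mA AD.
    by rewrite /m/= /mrestr setIidl.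
  rewrite [RHS](@ge0_negligible_integral _ _ _ _ setT (~` D))//.
  - by rewrite setDE setCK setTI.
  - exact: measurableC.
  - by rewrite /m/= /mrestr setICl measure0.
transitivity (\int[pushforward m g]_b psi b).
  by rewrite ge0_integral_pushforward.
have mE G : measurable G -> pushforward m g G = \int[distribution P g]_(b in G) p b.
  move=> mG; rewrite /pushforward/= /m/= /mrestr/= setIC DE//.
  by rewrite [RHS]ge0_integral_pushforward//; exact: measurable_funTS.
rewrite (@ge0_integral_density _ _ _ (distribution P g) p)//.
  rewrite (ge0_integral_distribution (g : {RV P >-> _}))//; first exact: emeasurable_funM.
  by move=> b; rewrite mule_ge0.
apply: (@le_lt_trans _ _ 1); last by rewrite ltry.
by apply: probability_le1; apply: measurableI => //; exact: measurable_preimage_mfun.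
Qed.

End restricted_law.

Section relative_entropy.
Context d (T : measurableType d) (R : realType) (P Q : probability T R).

(** Supplies the hypotheses of [gibbs]. The integral of 1/g under [P] is the [Q]-measure of the set
    where [g] is positive, since the product of [g] with its total inverse is 0 elsewhere. *)
Lemma density_gibbs (g : T -> R) : measurable_fun setT g -> (forall x, (0 <= g x)%R) ->
  (forall E, measurable E -> P E = \int[Q]_(x in E) (g x)%:E) ->
  {ae P, forall x, (0 < g x)%R} /\ \int[P]_x (g x)^-1%:E <= 1.
Proof.
move=> mg g0 PE; have mgE : measurable_fun setT (EFin \o g) by exact/measurable_EFinP.
have mgV : measurable_fun setT (fun x => (g x)^-1%:E).
  by apply/measurable_EFinP; apply: (measurableT_comp (@measurable_invr R)).
split.
  have mN : measurable (g @^-1` [set 0%R]).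
    by rewrite -[X in measurable X]setTI; exact: mg.
  exists (g @^-1` [set 0%R]); split => //.
    by rewrite PE// integral0_eq// => x /= ->.
  by move=> x/= /negP; rewrite -leNgt => gx; apply/eqP; rewrite eq_le gx g0.
rewrite (@ge0_integral_density _ _ _ Q (EFin \o g))//.
- rewrite -(probability_setT Q) -[leRHS]mul1e -integral_cst//.
  apply: ge0_le_integral => //.
  + by move=> x _; rewrite -EFinM lee_fin mulr_ge0// invr_ge0.
  + exact: emeasurable_funM.
  move=> x _ /=; rewrite -EFinM lee_fin.
  by have [->|gx] := eqVneq (g x) 0%R; rewrite ?mulr0// mulVf.
- by rewrite [X in X < _]probability_setT ltry.
- by move=> x; rewrite lee_fin invr_ge0.
Qed.

(** Any version of the density may be used: versions agree almost everywhere for [Q], hence for [P],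
    which [Q] dominates. *)
Lemma relative_entropyE (g : T -> R) : measurable_fun setT g -> (forall x, (0 <= g x)%R) ->
  (forall E, measurable E -> P E = \int[Q]_(x in E) (g x)%:E) ->
  relative_entropy P Q = \int[P]_x (log2 (g x))%:E.
Proof.
move=> mg g0 PE; have mgE : measurable_fun setT (EFin \o g) by exact/measurable_EFinP.
have PQ : P `<< Q.
  apply/null_content_dominatesP => A mA A0; rewrite PE//.
  by rewrite null_set_integral//; exact: measurable_funTS.
rewrite /relative_entropy asboolT//.
set r := Radon_Nikodym _ _.
have ir : Q.-integrable setT r by exact: Radon_Nikodym_integrable.
have mr : measurable_fun setT r by exact: measurable_int ir.
have rg : ae_eq Q setT r (EFin \o g).
  apply: integral_ae_eq => // E _ mE; rewrite -PE//.
  by rewrite -Radon_Nikodym_integral.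
apply: ae_eq_integral => //.
- apply/measurable_EFinP; apply: (measurableT_comp (@measurable_log2 R)).
  exact: measurableT_comp.
- by apply/measurable_EFinP; apply: (measurableT_comp (@measurable_log2 R)).
have := null_dominates_ae_eq measurableT PQ rg.
by apply: filterS => x h _; have := h I => /= ->.
Qed.

Lemma relative_entropy_ge0 : 0 <= relative_entropy P Q.
Proof.
have [PQ|nPQ] := pselect (P `<< Q); last by rewrite /relative_entropy asboolF// leey.
pose r := Radon_Nikodym_SigmaFinite.f P Q.
have r0 x : 0 <= r x by exact: Radon_Nikodym_SigmaFinite.f_ge0.
have rfin x : r x \is a fin_num by exact: Radon_Nikodym_SigmaFinite.f_fin_num.
have mr : measurable_fun setT r.
  exact: measurable_int (Radon_Nikodym_SigmaFinite.f_integrable PQ).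
pose g x := fine (r x).
have mg : measurable_fun setT g by exact: measurableT_comp.
have g0 x : (0 <= g x)%R by exact: fine_ge0.
have PE E : measurable E -> P E = \int[Q]_(x in E) (g x)%:E.
  move=> mE; rewrite (Radon_Nikodym_SigmaFinite.f_integral PQ)//.
  by apply: eq_integral => x _; rewrite fineK.
have [g_gt0 gV1] := density_gibbs mg g0 PE.
by rewrite (relative_entropyE mg g0 PE); have [] := gibbs mg g0 g_gt0 gV1.
Qed.

End relative_entropy.

Section information.
Context d (W : measurableType d) (R : realType) (P : probability W R).

Lemma relative_entropy_distributionE d' (T : measurableType d')
    (f : {mfun W >-> T}) (Q : probability T R) (g : T -> R) :
  measurable_fun setT g -> (forall x, (0 <= g x)%R) ->
  (forall E, measurable E -> distribution P f E = \int[Q]_(x in E) (g x)%:E) ->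
  relative_entropy (distribution P f) Q = \int[P]_w (log2 (g (f w)))%:E /\
  neg_int P (fun w => log2 (g (f w))) < +oo.
Proof.
move=> mg g0 PE; have [g_gt0 gV1] := density_gibbs mg g0 PE.
have mlg : measurable_fun setT (fun x => log2 (g x)).
  exact: (measurableT_comp (@measurable_log2 R)).
have [h1 h2] := integral_distribution_real P f mlg.
rewrite (relative_entropyE mg g0 PE) h1; split=> //.
by have [+ _ _] := gibbs mg g0 g_gt0 gV1; rewrite [X in X < _]h2.
Qed.

Section mutual_information.
Context d1 d2 (A : measurableType d1) (B : measurableType d2).
Variables (f : {RV P >-> A}) (g : {RV P >-> B}).

Lemma mutual_info_ge0 : 0 <= mutual_info f g.
Proof. exact: (@relative_entropy_ge0 _ _ _ _ (_ \x _ : probability _ R)). Qed.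

Lemma mutual_infoE (k : A * B -> R) : conditional_density P f g k ->
  mutual_info f g = \int[P]_w (log2 (k (f w, g w)))%:E /\
  neg_int P (fun w => log2 (k (f w, g w))) < +oo.
Proof.
move=> [mk k0 _ fgE].
exact: (@relative_entropy_distributionE _ _ (rv_pair f g)
  (distribution P f \x distribution P g : probability _ R) k).
Qed.

(** Mutual information is symmetric, so the density of [f] given [g] serves as well; this is the
    form that fits the factor P(X,Y|Xh,Yh)/P(X,Y). *)
Lemma mutual_info_swapE (k : B * A -> R) : conditional_density P g f k ->
  mutual_info f g = \int[P]_w (log2 (k (g w, f w)))%:E /\
  neg_int P (fun w => log2 (k (g w, f w))) < +oo.
Proof.
move=> [mk k0 _ gfE].
have ms : measurable_fun setT (k \o @unstable.swap A B) by apply: measurableT_comp => //; exact: measurable_swap.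
apply: (@relative_entropy_distributionE _ _ (rv_pair f g)
  (distribution P f \x distribution P g : probability _ R) (k \o @unstable.swap A B)) => //.
  by move=> x; exact: k0.
move=> E mE.
have mE' : measurable (@unstable.swap B A @^-1` E).
  by rewrite -[X in measurable X]setTI; exact: measurable_swap.
transitivity (distribution P (rv_pair g f) (@unstable.swap B A @^-1` E)) => //.
rewrite gfE// integral_mkcond [RHS]integral_mkcond.
rewrite fubini_tonelli1; last 2 first.
- apply/(measurable_restrictT _ _).1 => //; apply: measurable_funTS; exact/measurable_EFinP.
- by move=> z; apply: erestrict_ge0 => z' _; rewrite lee_fin.
rewrite fubini_tonelli2; last 2 first.
- apply/(measurable_restrictT _ _).1 => //; apply: measurable_funTS; exact/measurable_EFinP.
- by move=> z; apply: erestrict_ge0 => z' _; rewrite lee_fin; exact: k0.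
apply: eq_integral => b _; apply: eq_integral => a _.
by rewrite !patchE in_preimage.
Qed.

End mutual_information.

End information.

(** * Conditional kernels and Markov chains *)

Section conditional_kernels.
Context d (W : measurableType d) (R : realType) (P : probability W R).

Lemma integral_preimage_restrict d2 (B : measurableType d2) (g : {mfun W >-> B})
    (D : set W) (G : set B) (psi : B -> \bar R) :
  \int[P]_(w in D `&` g @^-1` G) psi (g w) = \int[P]_(w in D) (psi \_ G) (g w).
Proof.
rewrite integral_mkcondr; apply: eq_integral => w _.
by rewrite !patchE in_preimage.
Qed.

Lemma cond_distribution_integral d1 d2 (A : measurableType d1)
    (B : measurableType d2) (f : {RV P >-> A}) (g : {RV P >-> B})
    (k : R.-pker A ~> B) : cond_distribution f g k ->
  forall (F : set B) (G : set A) (psi : A -> \bar R),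
    measurable F -> measurable G ->
    measurable_fun setT psi -> (forall a, 0 <= psi a) ->
  \int[P]_(w in f @^-1` G `&` g @^-1` F) psi (f w) =
  \int[P]_(w in f @^-1` G) (psi (f w) * k (f w) F).
Proof.
move=> fgk F G psi mF mG mpsi psi0.
have mpsiG : measurable_fun setT (psi \_ G).
  by apply/(measurable_restrictT _ _).1 => //; exact: measurable_funTS.
rewrite setIC integral_preimage_restrict.
rewrite (@integral_restricted_law _ _ _ _ _ P f _ (fun a => k a F))//.
- rewrite [RHS]integral_mkcond; apply: eq_integral => w _.
  by rewrite !patchE (in_preimage f G w); case: ifP => //; rewrite mul0e.
- exact: measurable_preimage_mfun.
- exact: measurable_kernel.
- by move=> H mH; rewrite setIC fgk.
- by move=> a; exact: erestrict_ge0.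
Qed.

(** The definition conditions [h] on (f, g), while here [f] is conditioned on (g, h). Both express
    P(f, h | g) = P(f | g) P(h | g). *)
Lemma markov_chainP d1 d2 d3 (A : measurableType d1) (B : measurableType d2)
    (C : measurableType d3) (f : {RV P >-> A}) (g : {RV P >-> B})
    (h : {RV P >-> C}) (kf : R.-pker B ~> A) (kh : R.-pker B ~> C) :
  cond_distribution g f kf -> cond_distribution g h kh ->
  markov_chain f g h <->
  forall F G E, measurable F -> measurable G -> measurable E ->
    P (f @^-1` F `&` g @^-1` G `&` h @^-1` E) =
    \int[P]_(w in g @^-1` G `&` h @^-1` E) kf (g w) F.
Proof.
move=> gfk ghk.
have mker d' (T : measurableType d') (k : R.-pker B ~> T) (F : set T) :
    measurable F -> measurable_fun setT (fun b => k b F) by exact: measurable_kernel.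
split=> [fgh F G E mF mG mE|fgh E mE].
  have [phi [mphi phi0 phiE]] := fgh E mE.
  rewrite phiE// (setIC (f @^-1` F)) (cond_distribution_integral gfk)//.
  rewrite setIC (integral_preimage_restrict g _ _ (fun b => kf b F)).
  rewrite (@integral_restricted_law _ _ _ _ _ P g _ phi)//.
  - rewrite integral_mkcond; apply: eq_integral => w _.
    rewrite !patchE (in_preimage g G w); case: ifP => _; last by rewrite mul0e.
    by rewrite muleC.
  - exact: measurable_preimage_mfun.
  (* With [F] the whole space, the identity for [phi] identifies phi(g) as the conditional
     probability of [h] in [E] given [g] alone. *)
  - move=> H mH; have := phiE setT H measurableT mH.
    by rewrite preimage_setT !setTI setIC => ->.
  - by apply/(measurable_restrictT _ _).1 => //; apply: measurable_funTS; exact: mker.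
  - by move=> b; exact: erestrict_ge0.
exists (fun b => kh b E); split => //; first exact: mker.
move=> F G mF mG; rewrite fgh// (setIC (f @^-1` F)).
rewrite (cond_distribution_integral gfk (psi := fun b => kh b E))//; last exact: mker.
rewrite (cond_distribution_integral ghk (psi := fun b => kf b F))//; last exact: mker.
by apply: eq_integral => w _; rewrite muleC.
Qed.

End conditional_kernels.

(** * Conditional mutual information as the integral of a log ratio *)

Section conditional_mutual_information.
Context d (W : measurableType d) (R : realType) (P : probability W R).
Context d1 d2 d3 (A : measurableType d1) (B : measurableType d2)
  (C : measurableType d3).
Variables (f : {RV P >-> A}) (g : {RV P >-> B}) (h : {RV P >-> C}).

Lemma cond_mutual_info_ge0 : 0 <= cond_mutual_info f g h.
Proof.
by apply: le_ereal_inf_tmp => v [kf [kg [Q [_ _ _ ->]]]]; exact: relative_entropy_ge0.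
Qed.

Variables (k : A * C * B -> R) (r : C * B -> R) (kf : R.-pker C ~> A).
Hypothesis fhg : conditional_density P (rv_pair f h) g k.
Hypothesis hg : conditional_density P h g r.
Hypothesis hf : cond_distribution h f kf.

(** P(g|f,h)/P(g|h), the density of the law of (f, g, h) with respect to P(f|h) P(g|h) P(h). *)
Let G (z : A * B * C) := (k ((z.1.1, z.2), z.1.2) / r (z.2, z.1.2))%R.

(** The reference law is built with [g] last, over the law of (f, h); [s] restores the order used in
    [cond_mutual_info]. *)
Let s (z : A * C * B) : A * B * C := ((z.1.1, z.2), z.1.2).

Let ms : measurable_fun setT s.
Proof.
apply: measurable_fun_pair; last exact: measurableT_comp.
by apply: measurable_fun_pair => //; exact: measurableT_comp.
Qed.

HB.instance Definition _ := isMeasurableFun.Build _ _ _ _ s ms.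

Let mk : measurable_fun setT k. Proof. by case: fhg. Qed.
Let k0 z : (0 <= k z)%R. Proof. by case: fhg. Qed.
Let mr : measurable_fun setT r. Proof. by case: hg. Qed.
Let r0 z : (0 <= r z)%R. Proof. by case: hg. Qed.

Let mG : measurable_fun setT G.
Proof.
have m11 : measurable_fun setT (fun z : A * B * C => z.1.1) by exact: measurableT_comp.
have m12 : measurable_fun setT (fun z : A * B * C => z.1.2) by exact: measurableT_comp.
apply: measurable_funM.
  apply: (measurableT_comp mk); apply: measurable_fun_pair => //.
  exact: measurable_fun_pair.
apply: (measurableT_comp (@measurable_invr R)); apply: (measurableT_comp mr).
exact: measurable_fun_pair.
Qed.

Let m : probability (A * C * B)%type R :=
  (distribution P (rv_pair f h) \x distribution P g : probability _ R).

Let mrs : measurable_fun setT (fun z : A * C * B => r (z.1.2, z.2)).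
Proof.
apply: (measurableT_comp mr); apply: measurable_fun_pair => //.
exact: measurableT_comp.
Qed.

(** The law that keeps (f, h) and redraws [g] from [h] alone, that is P(f|h) P(g|h) P(h). *)
Let reference_exists : exists Q : probability (A * C * B)%type R,
  forall E, measurable E -> Q E = \int[m]_(z in E) (r (z.1.2, z.2))%:E.
Proof.
apply: density_probability; first exact/measurable_EFinP.
  by move=> z; rewrite lee_fin.
rewrite fubini_tonelli1/=; last 2 first.
- exact/measurable_EFinP.
- by move=> z; rewrite lee_fin.
rewrite -(probability_setT (distribution P (rv_pair f h))) -[RHS]mul1e -integral_cst//.
by apply: eq_integral => -[a c] _; rewrite /fubini_F/=; case: hg => _ _ ->.
Qed.

(** All admissible kernels define the same reference law, so the infimum ranges over one value; [kf]
    and the kernel made from [r] show that this value occurs. *)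
Lemma cond_mutual_infoE :
  cond_mutual_info f g h =
    \int[P]_w (log2 (k ((f w, h w), g w) / r (h w, g w))%R)%:E /\
  neg_int P (fun w => log2 (k ((f w, h w), g w) / r (h w, g w))%R) < +oo.
Proof.
have [Q QE] := reference_exists.
have [kg [kgE hgk]] := conditional_density_kernel hg.
(* Independence of versions: integrating over the event g in F absorbs [kg'], which is re-expanded
   as [kg]; integrating over f in E then absorbs [kf'], leaving an integral against the law of (f,
   h). *)
have Q0E E F H : measurable E -> measurable F -> measurable H ->
  forall (kf' : R.-pker C ~> A) (kg' : R.-pker C ~> B),
    cond_distribution h f kf' -> cond_distribution h g kg' ->
  distribution Q s (E `*` F `*` H) =
    \int[P]_(w in h @^-1` H) (kf' (h w) E * kg' (h w) F).
  move=> mE mF mH kf' kg' hf' hg'.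
  rewrite -(cond_distribution_integral hg' mF mH (psi := fun c => kf' c E))//; last first.
    exact: measurable_kernel.
  rewrite (cond_distribution_integral hgk mF mH (psi := fun c => kf' c E))//; last first.
    exact: measurable_kernel.
  under eq_integral do rewrite muleC.
  rewrite -(cond_distribution_integral hf' mE mH (psi := fun c => kg c F))//; last first.
    exact: measurable_kernel.
  have -> : distribution Q s (E `*` F `*` H) = Q ((E `*` H) `*` F).
    by rewrite /distribution /pushforward; congr (Q _); apply/seteqP; split => -[[a c] b]/=; tauto.
  rewrite QE; last by apply: measurableX => //; exact: measurableX.
  rewrite integral_mkcond fubini_tonelli1; last 2 first.
  - apply/(measurable_restrictT _ _).1; last by apply: measurable_funTS; exact/measurable_EFinP.
    by apply: measurableX => //; exact: measurableX.
  - by move=> z; apply: erestrict_ge0 => z' _; rewrite lee_fin.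
  transitivity (\int[distribution P (rv_pair f h)]_(z in E `*` H) kg z.2 F).
    rewrite [RHS]integral_mkcond; apply: eq_integral => -[a c] _.
    rewrite /fubini_F/= patchE; case: ifPn => ac.
      rewrite kgE// [RHS]integral_mkcond; apply: eq_integral => b _.
      by rewrite !patchE in_setX ac.
    by rewrite integral0_eq// => b _; rewrite patchE in_setX (negPf ac).
  rewrite [LHS]ge0_integral_pushforward//.
  - by rewrite [in RHS]setIC.
  - exact: measurableX.
  - apply: measurable_funTS.
    apply: (@measurableT_comp _ _ _ _ _ _ (fun c => kg c F) _ snd) => //.
    exact: measurable_kernel.
have QG (Q' : probability (A * B * C)%type R) :
    (forall E, measurable E -> Q' E = distribution Q s E) ->
  forall E, measurable E ->
    distribution P (rv_pair (rv_pair f g) h) E = \int[Q']_(z in E) (G z)%:E.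
  move=> Q'E E mE.
  have mE' : measurable (s @^-1` E).
    by rewrite -[X in measurable X]setTI; exact: ms.
  (* On [N] the quotient [G] is 0 by convention, so the formula misses the mass of the law there;
     that mass is 0 because [r] is almost surely positive. *)
  pose N := [set z : A * C * B | r (z.1.2, z.2) = 0%R].
  have mN : measurable N.
    by rewrite -[X in measurable X]setTI; exact: (mrs measurableT (measurable_set1 0%R)).
  have [_ _ _ fhgE] := fhg.
  pose J := distribution P (rv_pair (rv_pair f h) g).
  have J0 : J N = 0.
    have [M [mM M0 rM]] := conditional_density_gt0 hg.
    apply: (subset_measure0 _ mM _ M0).
      by apply: measurable_preimage_mfun.
    by apply: subset_trans rM => w; rewrite /N/= => -> ; rewrite ltxx.
  transitivity (J (s @^-1` E)) => //.
  transitivity (J (s @^-1` E `\` N)).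
    rewrite [RHS]measureD//; last first.
      by apply: (@le_lt_trans _ _ 1); [exact: probability_le1|exact: ltry].
    by rewrite (_ : _ (_ `&` _) = 0) ?sube0//; apply: subset_measure0 J0 => //; exact: measurableI.
  rewrite (eq_measure_integral (distribution Q s)); last by move=> F mF _; exact: Q'E.
  rewrite [RHS]ge0_integral_pushforward//; last 2 first.
  - by apply: measurable_funTS; exact/measurable_EFinP.
  - by move=> z _; rewrite lee_fin divr_ge0.
  rewrite (@ge0_integral_density _ _ _ m (fun z => (r (z.1.2, z.2))%:E))//; last 5 first.
  - exact/measurable_EFinP.
  - by move=> z; rewrite lee_fin.
  - by rewrite [X in X < _]probability_setT ltry.
  - by apply: measurable_funTS; apply/measurable_EFinP; apply: (measurableT_comp mG ms).
  - by move=> z; rewrite lee_fin divr_ge0.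
  rewrite [LHS]fhgE; last exact: measurableD.
  rewrite setDE integral_mkcondr; apply: eq_integral => z _.
  rewrite patchE /G/=; case: ifPn => [/set_mem|/negP].
    move=> /eqP rz; rewrite -EFinM -mulrA mulVf ?mulr1//.
    by case: z rz => -[].
  move=> Nz; have -> : r (z.1.2, z.2) = 0%R.
    by apply: contrapT => rz; apply: Nz; exact/mem_set.
  by rewrite invr0 mulr0 mul0e.
set v0 := \int[P]_w _.
have vE (Q' : probability (A * B * C)%type R) :
    (forall E, measurable E -> Q' E = distribution Q s E) ->
    relative_entropy (distribution P (rv_pair (rv_pair f g) h)) Q' = v0 /\
    neg_int P (fun w => log2 (k ((f w, h w), g w) / r (h w, g w))%R) < +oo.
  move=> Q'E; apply: (relative_entropy_distributionE mG _ (QG _ Q'E)).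
  by move=> z; rewrite divr_ge0.
have [v0E nv0] := vE (distribution Q s) (fun _ _ => erefl).
split=> //; rewrite /cond_mutual_info [X in ereal_inf X](_ : _ = [set v0]) ?ereal_inf1//.
apply/seteqP; split => [v [kf' [kg' [Q' [hf' hg' Q'E ->]]]]|_ ->].
  have [//|<- _] := vE Q'; last by [].
  apply: box3_unique => //; first by rewrite [X in X < _]probability_setT ltry.
  move=> E F H mE mF mH; transitivity (Q' (E `*` F `*` H)) => //.
  by rewrite Q'E//; apply/esym/Q0E.
exists kf, kg, (distribution Q s : probability _ R); split => //.
by move=> E F H mE mF mH; rewrite [LHS](Q0E _ _ _ _ _ _ kf kg)//.
Qed.

End conditional_mutual_information.

(** * Joint laws and product references *)

Ltac measurable_proj := repeat first
  [ exact: measurable_id | exact: measurable_fst | exact: measurable_snd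
  | apply: measurable_fun_pair | apply: (measurableT_comp measurable_fst)
  | apply: (measurableT_comp measurable_snd) ].

Section sigma_finite_product.
Context d1 d2 (A : measurableType d1) (B : measurableType d2) (R : realType).
Variables (m1 : {sigma_finite_measure set A -> \bar R})
          (m2 : {sigma_finite_measure set B -> \bar R}).

(* The library's sigma-finite structure on [m1 \x m2] is only inferred for
   (sub)probabilities, hence the alias. *)
Definition sigma_finite_product : set (A * B) -> \bar R := m1 \x m2.

HB.instance Definition _ := Measure.on sigma_finite_product.

Let sigma_finite_productT : sigma_finite setT sigma_finite_product.
Proof.
have /sigma_finiteP[F [TF ndF Foo]] := sigma_finiteT m1.
have /sigma_finiteP[G [TG ndG Goo]] := sigma_finiteT m2.
exists (fun n => F n `*` G n).
  rewrite -setXTT TF TG; apply/seteqP; split => -[x y] /=; last first.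
    by move=> [n _ []/= ? ?]; split; exists n.
  move=> [[n _ Fnx] [k _ Gky]]; exists (maxn n k) => //; split.
    by move: x Fnx; exact/subsetPset/ndF/leq_maxl.
  by move: y Gky; exact/subsetPset/ndG/leq_maxr.
move=> k; have [? ?] := Foo k; have [? ?] := Goo k.
split; first exact: measurableX.
by rewrite [X in X < _]product_measure1E// lte_mul_pinfty// ge0_fin_numE.
Qed.

HB.instance Definition _ := Measure_isSigmaFinite.Build _ _ _
  sigma_finite_product sigma_finite_productT.

Lemma dominates_product_marginals (J : probability (A * B)%type R) :
  J `<< m1 \x m2 ->
  [/\ distribution J fst `<< m1, distribution J snd `<< m2 &
      J `<< distribution J fst \x distribution J snd].
Proof.
move=> Jm; split; last first.
- apply: dominates_marginals Jm => E mE; rewrite /distribution /pushforward;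
    by congr (J _); apply/seteqP; split => -[x y] /=; tauto.
- apply/null_content_dominatesP => E mE E0; move/null_content_dominatesP : Jm.
  move=> /(_ (setT `*` E)); rewrite [X in X = 0 -> _]product_measure1E// E0 mule0.
  move=> Jm; rewrite -[RHS](Jm _ erefl); last exact: measurableX.
  by rewrite /distribution /pushforward; congr (J _); apply/seteqP; split => -[x y] /=; tauto.
- apply/null_content_dominatesP => E mE E0; move/null_content_dominatesP : Jm.
  move=> /(_ (E `*` setT)); rewrite [X in X = 0 -> _]product_measure1E// E0 mul0e.
  move=> Jm; rewrite -[RHS](Jm _ erefl); last exact: measurableX.
  by rewrite /distribution /pushforward; congr (J _); apply/seteqP; split => -[x y] /=; tauto.
Qed.

End sigma_finite_product.

(** * The product reference law and existence of conditional densities *)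

Section reference_product.
Context da du db dc (A : measurableType da) (U : measurableType du)
  (B : measurableType db) (C : measurableType dc) (R : realType).
Variables (pa : probability A R) (pu : probability U R) (pb : probability B R)
  (pc : probability C R).

Definition reference_law : probability (A * U * B * C)%type R :=
  (((pa \x pu : probability _ R) \x pb : probability _ R) \x pc : probability _ R).

Definition reference_ubc : probability (U * B * C)%type R :=
  ((pu \x pb : probability _ R) \x pc : probability _ R).

(** The order of integration for densities in which Xh and Yh are drawn last. *)
Lemma integral_reference1 (F : A * U * B * C -> \bar R) :
  measurable_fun setT F -> (forall w, 0 <= F w) ->
  \int[reference_law]_w F w =
  \int[pa \x pu]_s \int[pb]_b \int[pc]_c F (s, b, c).
Proof.
move=> mF F0; rewrite fubini_tonelli1// fubini_tonelli1//.
- exact: measurable_fun_fubini_tonelli_F.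
- by move=> z; apply: integral_ge0.
Qed.

(** The order of integration for densities in which (X, Y) is drawn last, given (Xh, Yh). *)
Lemma integral_reference2 (F : A * U * B * C -> \bar R) :
  measurable_fun setT F -> (forall w, 0 <= F w) ->
  \int[reference_law]_w F w =
  \int[reference_ubc]_z \int[pa]_a F (a, z.1.1, z.1.2, z.2).
Proof.
move=> mF F0.
pose H (z : U * B * C) := \int[pa]_a F (a, z.1.1, z.1.2, z.2).
have mH : measurable_fun setT H.
  apply: (measurable_fun_fubini_tonelli_G
    (fun z : A * (U * B * C) => F (z.1, z.2.1.1, z.2.1.2, z.2.2))) => //.
  apply: (measurableT_comp mF).
  by measurable_proj.
have H0 z : 0 <= H z by exact: integral_ge0.
rewrite fubini_tonelli2// [RHS]fubini_tonelli2//.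
apply: eq_integral => c _; rewrite /fubini_G.
have mFc : measurable_fun setT (fun z : A * U * B => F (z, c)).
  exact: (measurableT_comp mF (measurable_pair2 c)).
have mHc : measurable_fun setT (fun z : U * B => H (z, c)).
  exact: (measurableT_comp mH (measurable_pair2 c)).
rewrite fubini_tonelli2// [RHS]fubini_tonelli2//.
apply: eq_integral => b _; rewrite /fubini_G.
rewrite fubini_tonelli2//.
  exact: (measurableT_comp mFc (measurable_pair2 b)).
by move=> z; exact: integral_ge0.
Qed.

Lemma reference_rectangle (S : set (A * U)) (T : set (B * C)) :
  measurable S -> measurable T ->
  reference_law [set w | S w.1.1 /\ T (w.1.2, w.2)] = (pa \x pu) S * (pb \x pc) T.
Proof.
move=> mS mT.
have mST : measurable [set w : A * U * B * C | S w.1.1 /\ T (w.1.2, w.2)].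
  apply: measurableI.
    rewrite -[X in measurable X]setTI; apply: (_ : measurable_fun setT (fun w : A * U * B * C => w.1.1)) => //.
    exact: measurableT_comp.
  rewrite -[X in measurable X]setTI.
  apply: (_ : measurable_fun setT (fun w : A * U * B * C => (w.1.2, w.2))) => //.
  by apply: measurable_fun_pair => //; exact: measurableT_comp.
rewrite -[LHS]mul1e -integral_cst// integral_mkcond integral_reference1; last 2 first.
- by apply/(measurable_restrictT _ _).1.
- by move=> w; exact: erestrict_ge0.
transitivity (\int[pa \x pu]_s ((cst ((pb \x pc) T)) \_ S) s); last first.
  by rewrite -integral_mkcond integral_cst// muleC.
apply: eq_integral => s _; rewrite [RHS]patchE; case: ifPn => sS.
  rewrite -[RHS]mul1e -integral_cst// [RHS]integral_mkcond fubini_tonelli1; last 2 first.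
  - by apply/(measurable_restrictT _ _).1.
  - by move=> w; exact: erestrict_ge0.
  apply: eq_integral => b _; apply: eq_integral => c _; rewrite !patchE.
  congr (if _ then _ else _); apply/idP/idP => /set_mem h; apply/mem_set => //.
    by case: h.
  by split => //; exact: set_mem.
rewrite integral0_eq// => b _; rewrite integral0_eq// => c _; rewrite patchE ifF//.
by apply/negbTE; apply: contra sS => /set_mem[/= ? _]; exact/mem_set.
Qed.

(** Independence makes the reference law of (f, g) a product, which dominates the law of (f, g)
    under [P]; [dominates_marginals] then replaces its factors by the marginals of [P]. *)
Lemma product_independent_density (P : probability (A * U * B * C)%type R)
    ds dt (S : measurableType ds) (T : measurableType dt)
    (f : {mfun (A * U * B * C)%type >-> S}) (g : {mfun (A * U * B * C)%type >-> T}) :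
  P `<< reference_law ->
  (forall E F, measurable E -> measurable F ->
    reference_law (f @^-1` E `&` g @^-1` F) =
    reference_law (f @^-1` E) * reference_law (g @^-1` F)) ->
  exists k, conditional_density P f g k.
Proof.
move=> Pm fg; apply: conditional_density_exists.
apply: (@dominates_marginals _ _ _ _ _ (distribution reference_law f) (distribution reference_law g)).
- move=> E mE; rewrite /distribution /pushforward;
    by congr (P _); apply/seteqP; split => w //= [].
- move=> E mE; rewrite /distribution /pushforward;
    by congr (P _); apply/seteqP; split => w //= [].
apply/null_content_dominatesP => N mN N0.
move/null_content_dominatesP : Pm; apply; first exact: (measurable_preimage_mfun (rv_pair f g)).
transitivity (distribution reference_law (rv_pair f g) N) => //.
by rewrite -(product_measure_unique (m1 := distribution reference_law f)
  (m2 := distribution reference_law g)).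
Qed.

End reference_product.

Section joint_variables.
Context {R : realType}.
Context {dx dy du dxh dyh : measure_display}.
Context {X : measurableType dx} {Y : measurableType dy} {U : measurableType du}
  {Xh : measurableType dxh} {Yh : measurableType dyh}.
Variable P : probability (X * Y * U * Xh * Yh)%type R.

Definition reference_of : probability (X * Y * U * Xh * Yh)%type R :=
  reference_law (distribution P (rvXY P)) (distribution P (rvU P))
    (distribution P (rvXh P)) (distribution P (rvYh P)).

Lemma rvXYE : (rvXY P : _ -> _) = (fun w => w.1.1.1).
Proof. by apply/funext => -[[[[x y] u] xh] yh]. Qed.

(** Splitting off one coordinate at a time replaces each reference measure by a marginal of [P]. The
    second part lets laws built from [P] inherit a joint density, since these marginals are
    dominated by the original reference measures. *)
Lemma joint_density_dominated : has_joint_density P ->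
  P `<< reference_of /\
  forall P' : probability (X * Y * U * Xh * Yh)%type R,
    P' `<< reference_of -> has_joint_density P'.
Proof.
move=> [mX [mY [mU [mXh [mYh [p [mp p0 PE]]]]]]].
pose m2 := sigma_finite_product mX mY : {sigma_finite_measure set _ -> \bar R}.
pose m3 := sigma_finite_product m2 mU : {sigma_finite_measure set _ -> \bar R}.
pose m4 := sigma_finite_product m3 mXh : {sigma_finite_measure set _ -> \bar R}.
pose m5 := sigma_finite_product m4 mYh : {sigma_finite_measure set _ -> \bar R}.
have Pm5 : P `<< m4 \x mYh.
  apply/null_content_dominatesP => A mA A0; rewrite PE//.
  by rewrite null_set_integral//; exact: measurable_funTS.
have [P4 hYh P5] := dominates_product_marginals Pm5.
have [P3 hXh P4'] := dominates_product_marginals P4.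
have [P2 hU P3'] := dominates_product_marginals P3.
have aE : distribution P (rvXY P) = distribution (distribution (distribution P fst) fst) fst.
  by rewrite /distribution rvXYE.
have Pref : P `<< reference_of.
  apply: (null_dominates_trans P5); apply: product_dominates; last exact: subset_refl.
  apply: (null_dominates_trans P4'); apply: product_dominates; last exact: subset_refl.
  apply: (null_dominates_trans P3'); apply: product_dominates; last exact: subset_refl.
  by rewrite [X in _ `<< X]aE; exact: subset_refl.
split=> // P' P'ref.
have P'm5 : P' `<< m5.
  apply: (null_dominates_trans P'ref).
  apply: product_dominates => //; apply: product_dominates => //.
  by apply: product_dominates => //; rewrite [X in X `<< _]aE.
exists mX, mY, mU, mXh, mYh, (Radon_Nikodym_SigmaFinite.f P' m5); split.
- exact: measurable_int (Radon_Nikodym_SigmaFinite.f_integrable P'm5).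
- exact: Radon_Nikodym_SigmaFinite.f_ge0.
- by move=> E mE; rewrite (Radon_Nikodym_SigmaFinite.f_integral P'm5).
Qed.

Let W := (X * Y * U * Xh * Yh)%type.

Hypothesis Pref : P `<< reference_of.

Let rect (S : set (X * Y * U)) (T : set (Xh * Yh)) :=
  [set w : W | S w.1.1 /\ T (w.1.2, w.2)].

(** Under the reference law (X, Y, U) and (Xh, Yh) are independent, so a function of the first group
    and one of the second have conditional densities in both directions. *)
Let left_density ds dt (S : measurableType ds) (T : measurableType dt)
    (f : {mfun W >-> S}) (g : {mfun W >-> T}) :
  (forall E, measurable E -> exists2 E', measurable E' & f @^-1` E = rect E' setT) ->
  (forall F, measurable F -> exists2 F', measurable F' & g @^-1` F = rect setT F') ->
  (exists k, conditional_density P f g k) /\ (exists k, conditional_density P g f k).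
Proof.
move=> fr gr.
have h E F : measurable E -> measurable F ->
    reference_of (f @^-1` E `&` g @^-1` F) =
    reference_of (f @^-1` E) * reference_of (g @^-1` F).
  move=> mE mF; have [E' mE' ->] := fr E mE; have [F' mF' ->] := gr F mF.
  have -> : rect E' setT `&` rect setT F' = rect E' F'.
    by apply/seteqP; split => w; rewrite /rect/=; tauto.
  rewrite [LHS]reference_rectangle// [X in _ = X * _]reference_rectangle//.
  rewrite [X in _ = _ * X]reference_rectangle//.
  rewrite [X in _ = _ * X * _](@probability_setT _ _ _ (_ \x _ : probability _ R)).
  by rewrite [X in _ = _ * (X * _)](@probability_setT _ _ _ (_ \x _ : probability _ R)) mule1 mul1e.
split; apply: product_independent_density Pref _ => //.
by move=> F E mF mE; rewrite setIC h// muleC.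
Qed.

Let XY_left E : measurable E ->
  exists2 E', measurable E' & rvXY P @^-1` E = rect E' setT.
Proof.
move=> mE; exists (E `*` setT); first exact: measurableX.
by rewrite rvXYE; apply/seteqP; split => w; rewrite /rect/=; tauto.
Qed.

Let U_left E : measurable E ->
  exists2 E', measurable E' & rvU P @^-1` E = rect E' setT.
Proof.
move=> mE; exists (setT `*` E); first exact: measurableX.
by apply/seteqP; split => w; rewrite /rect/=; tauto.
Qed.

Let XU_left E : measurable E ->
  exists2 E', measurable E' & rv_pair (rvX P) (rvU P) @^-1` E = rect E' setT.
Proof.
move=> mE; exists ((fun s : X * Y * U => (s.1.1, s.2)) @^-1` E).
  rewrite -[X in measurable X]setTI.
  apply: (_ : measurable_fun setT (fun s : X * Y * U => (s.1.1, s.2))) => //.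
  by measurable_proj.
by apply/seteqP; split => w; rewrite /rect/=; tauto.
Qed.

Let YU_left E : measurable E ->
  exists2 E', measurable E' & rv_pair (rvY P) (rvU P) @^-1` E = rect E' setT.
Proof.
move=> mE; exists ((fun s : X * Y * U => (s.1.2, s.2)) @^-1` E).
  rewrite -[X in measurable X]setTI.
  apply: (_ : measurable_fun setT (fun s : X * Y * U => (s.1.2, s.2))) => //.
  by measurable_proj.
by apply/seteqP; split => w; rewrite /rect/=; tauto.
Qed.

Let Xh_right F : measurable F ->
  exists2 F', measurable F' & rvXh P @^-1` F = rect setT F'.
Proof.
move=> mF; exists (F `*` setT); first exact: measurableX.
by apply/seteqP; split => w; rewrite /rect/=; tauto.
Qed.

Let Yh_right F : measurable F ->
  exists2 F', measurable F' & rvYh P @^-1` F = rect setT F'.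
Proof.
move=> mF; exists (setT `*` F); first exact: measurableX.
by apply/seteqP; split => w; rewrite /rect/=; tauto.
Qed.

Let XhYh_right F : measurable F ->
  exists2 F', measurable F' & rvXhYh P @^-1` F = rect setT F'.
Proof.
move=> mF; exists F => //.
by apply/seteqP; split => w; rewrite /rect/=; tauto.
Qed.

(** The companion of [left_density] inside the first group, where (X, Y) and U are independent. *)
Let U_independent ds (S : measurableType ds) (f : {mfun W >-> S}) :
  (forall E, measurable E ->
    exists2 E' : set (X * Y), measurable E' & f @^-1` E = rvXY P @^-1` E') ->
  (exists k, conditional_density P f (rvU P) k) /\
  (exists k, conditional_density P (rvU P) f k).
Proof.
move=> fXY; have h E F : measurable E -> measurable F ->
    reference_of (f @^-1` E `&` rvU P @^-1` F) =
    reference_of (f @^-1` E) * reference_of (rvU P @^-1` F).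
  move=> mE mF; have [E' mE' ->] := fXY E mE.
  have hS S0 (mS0 : measurable S0) : reference_of (rect S0 setT) =
      (distribution P (rvXY P) \x distribution P (rvU P)) S0.
    rewrite [LHS]reference_rectangle//.
    by rewrite [X in _ * X](@probability_setT _ _ _ (_ \x _ : probability _ R)) mule1.
  have XE : rvXY P @^-1` E' = rect (E' `*` setT) setT.
    by rewrite rvXYE; apply/seteqP; split => w; rewrite /rect/=; tauto.
  have UE : rvU P @^-1` F = rect (setT `*` F) setT.
    by apply/seteqP; split => w; rewrite /rect/=; tauto.
  have -> : rvXY P @^-1` E' `&` rvU P @^-1` F = rect (E' `*` F) setT.
    by rewrite XE UE; apply/seteqP; split => w; rewrite /rect/=; tauto.
  rewrite XE UE !hS; try exact: measurableX.
  rewrite !(product_measure1E (distribution P (rvXY P)) (distribution P (rvU P)))//.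
  by rewrite [X in _ = _ * X * _]probability_setT [X in _ = _ * (X * _)]probability_setT mule1 mul1e.
split; apply: product_independent_density Pref _ => //.
by move=> F E mF mE; rewrite setIC h// muleC.
Qed.

Lemma density_U_given_XY : exists k, conditional_density P (rvXY P) (rvU P) k.
Proof. by apply: (U_independent _).1 => E mE; exists E. Qed.

Lemma density_X_given_U : exists k, conditional_density P (rvU P) (rvX P) k.
Proof.
apply: (U_independent _).2 => E mE; exists (E `*` setT); first exact: measurableX.
by apply/seteqP; split => w /=; tauto.
Qed.

Lemma density_Y_given_U : exists k, conditional_density P (rvU P) (rvY P) k.
Proof.
apply: (U_independent _).2 => E mE; exists (setT `*` E); first exact: measurableX.
by apply/seteqP; split => w /=; tauto.
Qed.

Lemma density_Xh_given_XU : exists k, conditional_density P (rv_pair (rvX P) (rvU P)) (rvXh P) k.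
Proof. exact: (left_density XU_left Xh_right).1. Qed.

Lemma density_Yh_given_YU : exists k, conditional_density P (rv_pair (rvY P) (rvU P)) (rvYh P) k.
Proof. exact: (left_density YU_left Yh_right).1. Qed.

Lemma density_Xh_given_U : exists k, conditional_density P (rvU P) (rvXh P) k.
Proof. exact: (left_density U_left Xh_right).1. Qed.

Lemma density_Yh_given_U : exists k, conditional_density P (rvU P) (rvYh P) k.
Proof. exact: (left_density U_left Yh_right).1. Qed.

Lemma density_XY_given_XhYh : exists k, conditional_density P (rvXhYh P) (rvXY P) k.
Proof. exact: (left_density XY_left XhYh_right).2. Qed.

Lemma density_XhYh_given_XY : exists k, conditional_density P (rvXY P) (rvXhYh P) k.
Proof. exact: (left_density XY_left XhYh_right).1. Qed.

Lemma density_U_given_XhYh : exists k, conditional_density P (rvXhYh P) (rvU P) k.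
Proof. exact: (left_density U_left XhYh_right).2. Qed.

End joint_variables.

(** * Comparison of the rates *)

Section gibbs_compare.
Context d (T : measurableType d) (R : realType) (P : probability T R).

(** [gibbs] for the ratio q/p, whose inverse is p/q. The integral of log p may be +oo, hence the
    finiteness condition before cancelling it in the equality case. *)
Lemma gibbs_compare (p q : T -> R) :
  measurable_fun setT p -> measurable_fun setT q ->
  (forall x, (0 <= p x)%R) -> (forall x, (0 <= q x)%R) ->
  {ae P, forall x, (0 < p x)%R} -> {ae P, forall x, (0 < q x)%R} ->
  neg_int P (fun x => log2 (p x)) < +oo ->
  \int[P]_x (p x / q x)%:E <= 1 ->
  \int[P]_x (log2 (p x))%:E <= \int[P]_x (log2 (q x))%:E /\
  (\int[P]_x (log2 (q x))%:E = \int[P]_x (log2 (p x))%:E ->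
   \int[P]_x (log2 (p x))%:E \is a fin_num -> {ae P, forall x, p x = q x}).
Proof.
move=> mp mq p0 q0 pgt qgt np pq.
pose g x := (q x / p x)%R.
have mg : measurable_fun setT g.
  by apply: measurable_funM => //; apply: (measurableT_comp (@measurable_invr R)).
have g0 x : (0 <= g x)%R by exact: divr_ge0.
have ggt : {ae P, forall x, (0 < g x)%R}.
  by apply: filterS2 pgt qgt => x px qx; exact: divr_gt0.
have gV : \int[P]_x (g x)^-1%:E <= 1.
  by under eq_integral do rewrite /g invf_div.
have [ng Lge0 L0] := gibbs mg g0 ggt gV.
have ml (f : T -> R) : measurable_fun setT f -> measurable_fun setT (fun x => log2 (f x)).
  by move=> mf; exact: (measurableT_comp (@measurable_log2 R)).
have [_ sE] := integralD_neg (ml _ mp) (ml _ mg) np ng.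
have qE : \int[P]_x (log2 (q x))%:E =
    \int[P]_x (log2 (p x))%:E + \int[P]_x (log2 (g x))%:E.
  rewrite -sE; apply: ae_eq_integral => //.
  - by apply/measurable_EFinP; exact: ml.
  - by apply/measurable_EFinP; apply: measurable_funD; exact: ml.
  - apply: filterS2 pgt qgt => x px qx _; rewrite /= -log2M//; last exact: divr_gt0.
    by rewrite /g mulrC divfK// gt_eqF.
rewrite qE; split; first by rewrite leeDl.
move=> pp pfin; have {}/L0 : \int[P]_x (log2 (g x))%:E = 0.
  move: pp pfin; case: (\int[P]_x (log2 (p x))%:E) => // a.
  case: (\int[P]_x (log2 (g x))%:E) => // b; rewrite -EFinD => -[ab] _.
  by congr EFin; lra.
by apply: filterS2 pgt => x px gx; have := divfK (lt0r_neq0 px) (q x); rewrite -/(g x) gx mul1r.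
Qed.

Lemma log_sum (p q r : T -> R) :
  measurable_fun setT p -> measurable_fun setT q -> measurable_fun setT r ->
  {ae P, forall x, (0 < p x)%R} -> {ae P, forall x, (0 < q x)%R} ->
  {ae P, forall x, (0 < r x)%R} ->
  neg_int P (fun x => log2 (p x)) < +oo -> neg_int P (fun x => log2 (q x)) < +oo ->
  neg_int P (fun x => log2 (r x)) < +oo ->
  \int[P]_x (log2 (p x))%:E + \int[P]_x (log2 (q x))%:E + \int[P]_x (log2 (r x))%:E =
    \int[P]_x (log2 (p x * q x * r x)%R)%:E /\
  neg_int P (fun x => log2 (p x * q x * r x)%R) < +oo.
Proof.
move=> mp mq mr pgt qgt rgt np nq nr.
have ml (f : T -> R) : measurable_fun setT f -> measurable_fun setT (fun x => log2 (f x)).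
  by move=> mf; exact: (measurableT_comp (@measurable_log2 R)).
have [npq <-] := integralD_neg (ml _ mp) (ml _ mq) np nq.
have mlpq : measurable_fun setT (fun x => log2 (p x) + log2 (q x))%R.
  by apply: measurable_funD; exact: ml.
have [npqr <-] := integralD_neg mlpq (ml _ mr) npq nr.
have mlpqr : measurable_fun setT (fun x => log2 (p x) + log2 (q x) + log2 (r x))%R.
  by apply: measurable_funD => //; exact: ml.
have mlm : measurable_fun setT (fun x => log2 (p x * q x * r x)%R).
  by apply: ml; apply: measurable_funM => //; exact: measurable_funM.
have ae3 : {ae P, forall x, (log2 (p x) + log2 (q x) + log2 (r x) = log2 (p x * q x * r x))%R}.
  apply: filterS3 pgt qgt rgt => x px qx rx.
  by rewrite log2M ?mulr_gt0// log2M.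
split.
  apply: ae_eq_integral => //; [exact/measurable_EFinP..|].
  by apply: filterS ae3 => x -> _.
move: npqr; congr (_ < _); apply: ae_eq_integral => //.
- by apply/measurable_EFinP; apply: measurable_maxr => //; exact: measurable_funN.
- by apply/measurable_EFinP; apply: measurable_maxr => //; exact: measurable_funN.
- by apply: filterS ae3 => x -> _.
Qed.

Lemma integralM_EFin (r : R) (f : T -> R) : (0 <= r)%R -> measurable_fun setT f ->
  (forall x, (0 <= f x)%R) ->
  \int[P]_x (r * f x)%:E = r%:E * \int[P]_x (f x)%:E.
Proof.
move=> r0 mf f0; under eq_integral do rewrite EFinM.
rewrite ge0_integralZl_EFin//; first by move=> x _; rewrite lee_fin.
exact/measurable_EFinP.
Qed.

End gibbs_compare.

Section gray_wyner_densities.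
Context {R : realType}.
Context {dx dy du dxh dyh : measure_display}.
Context {X : measurableType dx} {Y : measurableType dy} {U : measurableType du}
  {Xh : measurableType dxh} {Yh : measurableType dyh}.
Variable P : probability (X * Y * U * Xh * Yh)%type R.
Variables (g1 : (X * Y) * U -> R) (k : (X * U) * Xh -> R) (l : (Y * U) * Yh -> R)
  (r : U * Xh -> R) (s : U * Yh -> R) (g : (Xh * Yh) * (X * Y) -> R).
Hypothesis Hg1 : conditional_density P (rvXY P) (rvU P) g1.
Hypothesis Hk : conditional_density P (rv_pair (rvX P) (rvU P)) (rvXh P) k.
Hypothesis Hl : conditional_density P (rv_pair (rvY P) (rvU P)) (rvYh P) l.
Hypothesis Hr : conditional_density P (rvU P) (rvXh P) r.
Hypothesis Hs : conditional_density P (rvU P) (rvYh P) s.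
Hypothesis Hg : conditional_density P (rvXhYh P) (rvXY P) g.

Let W := (X * Y * U * Xh * Yh)%type.
Let g1_ (w : W) := g1 (rvXY P w, rvU P w).
Let k_ (w : W) := k ((rvX P w, rvU P w), rvXh P w).
Let l_ (w : W) := l ((rvY P w, rvU P w), rvYh P w).
Let r_ (w : W) := r (rvU P w, rvXh P w).
Let s_ (w : W) := s (rvU P w, rvYh P w).
Let g_ (w : W) := g (rvXhYh P w, rvXY P w).

Let g1_0 w : (0 <= g1_ w)%R. Proof. by case: Hg1 => _ h _ _; exact: h. Qed.
Let k_0 w : (0 <= k_ w)%R. Proof. by case: Hk => _ h _ _; exact: h. Qed.
Let l_0 w : (0 <= l_ w)%R. Proof. by case: Hl => _ h _ _; exact: h. Qed.
Let r_0 w : (0 <= r_ w)%R. Proof. by case: Hr => _ h _ _; exact: h. Qed.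
Let s_0 w : (0 <= s_ w)%R. Proof. by case: Hs => _ h _ _; exact: h. Qed.
Let g_0 w : (0 <= g_ w)%R. Proof. by case: Hg => _ h _ _; exact: h. Qed.

Let mcomp d1 d2 (S : measurableType d1) (T : measurableType d2)
    (f : {mfun W >-> S}) (h : {mfun W >-> T}) (q : S * T -> R) :
  conditional_density P f h q -> measurable_fun setT (fun w => q (f w, h w)).
Proof.
move=> [mq _ _ _].
exact: (@measurableT_comp _ _ _ _ _ _ q _ (rv_pair f h)).
Qed.

Let mg1 : measurable_fun setT g1_. Proof. exact: mcomp Hg1. Qed.
Let mk : measurable_fun setT k_. Proof. exact: mcomp Hk. Qed.
Let ml : measurable_fun setT l_. Proof. exact: mcomp Hl. Qed.
Let mr : measurable_fun setT r_. Proof. exact: mcomp Hr. Qed.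
Let ms : measurable_fun setT s_. Proof. exact: mcomp Hs. Qed.
Let mg : measurable_fun setT g_. Proof. exact: mcomp Hg. Qed.

(* Density of the law that keeps the law of (X, Y, U) and draws Xh from (X, U)
   and Yh from (Y, U) independently of everything else. *)
Definition split_density (w : W) : R := (g1_ w * (k_ w * l_ w))%R.
(* Density of the law under which U is drawn first, then Xh and Yh independently
   given U, then (X, Y) given (Xh, Yh): it is the law of P exactly when both
   Markov conditions hold. *)
Definition markov_density (w : W) : R := (g_ w * (r_ w * s_ w))%R.
(* Its logarithm integrates to R0 + R1 + R2; it is the ratio of
   [split_density] to the product density of P(X,Y) and P(U)P(Xh|U)P(Yh|U). *)
Let sum_ratio (w : W) : R := (g1_ w * (k_ w / r_ w) * (l_ w / s_ w))%R.

Lemma measurable_split_density : measurable_fun setT split_density.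
Proof. by apply: measurable_funM => //; exact: measurable_funM. Qed.

Lemma measurable_markov_density : measurable_fun setT markov_density.
Proof. by apply: measurable_funM => //; exact: measurable_funM. Qed.

Let msum : measurable_fun setT sum_ratio.
Proof.
apply: measurable_funM; first apply: measurable_funM => //.
  by apply: measurable_funM => //; exact: (measurableT_comp (@measurable_invr R)).
by apply: measurable_funM => //; exact: (measurableT_comp (@measurable_invr R)).
Qed.

Lemma split_density_ge0 w : (0 <= split_density w)%R.
Proof. by rewrite !mulr_ge0. Qed.

Lemma markov_density_ge0 w : (0 <= markov_density w)%R.
Proof. by rewrite !mulr_ge0. Qed.

Let sum_ratio_ge0 w : (0 <= sum_ratio w)%R.
Proof. by rewrite !mulr_ge0// invr_ge0. Qed.

Let sum_ratio_gt0 : {ae P, forall w, (0 < sum_ratio w)%R}.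
Proof.
have h1 := conditional_density_gt0 Hg1.
have h2 := conditional_density_gt0 Hk.
have h3 := conditional_density_gt0 Hl.
have h4 := conditional_density_gt0 Hr.
have h5 := conditional_density_gt0 Hs.
apply: (filterS3 _ _ h1 h2 (filterI h3 (filterI h4 h5))) => w a1 a2 [a3 [a4 a5]].
by rewrite !mulr_gt0// invr_gt0.
Qed.

(** Integrating out Yh, then Xh, then U, each factor contributes 1 for every value of the variables
    still fixed. *)
Lemma split_density_integral :
  \int[reference_of P]_w (split_density w)%:E = 1.
Proof.
have [mq1 _ g11 _] := Hg1; have [mqk _ k1 _] := Hk; have [mql _ l1 _] := Hl.
rewrite integral_reference1; last 2 first.
- by apply/measurable_EFinP; exact: measurable_split_density.
- by move=> w; rewrite lee_fin split_density_ge0.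
transitivity (\int[distribution P (rvXY P) \x distribution P (rvU P)]_z (g1 z)%:E).
  apply: eq_integral => -[[x y] u] _.
  rewrite -[RHS]mule1 -(k1 (x, u)) -integralM_EFin; last 3 first.
  - by case: Hg1.
  - exact: (measurableT_comp mqk (measurable_pair1 _)).
  - by move=> b; case: Hk.
  apply: eq_integral => b _.
  rewrite -[RHS]mule1 -(l1 (y, u)) -integralM_EFin; last 3 first.
  - by apply: mulr_ge0; [case: Hg1|case: Hk].
  - exact: (measurableT_comp mql (measurable_pair1 _)).
  - by move=> c; case: Hl.
  by apply: eq_integral => c _; rewrite /split_density mulrA.
rewrite fubini_tonelli1; last 2 first.
- exact/measurable_EFinP.
- by move=> z; rewrite lee_fin; case: Hg1.
under eq_integral do rewrite /fubini_F g11.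
by rewrite integral_cst// mul1e; exact: probability_setT.
Qed.

(** An equality where [g_], [r_] and [s_] are nonzero; elsewhere the left side is 0. *)
Let ratio_le_split w : (sum_ratio w / g_ w * markov_density w <= split_density w)%R.
Proof.
have := split_density_ge0 w; rewrite /sum_ratio /markov_density /split_density.
have [->|g0] := eqVneq (g_ w) 0%R; first by rewrite !(invr0, mulr0, mul0r).
have [->|r0] := eqVneq (r_ w) 0%R; first by rewrite !(invr0, mulr0, mul0r).
have [->|s0] := eqVneq (s_ w) 0%R; first by rewrite !(invr0, mulr0, mul0r).
move=> _; rewrite le_eqVlt; apply/orP; left; apply/eqP; field.
by rewrite g0 r0 s0.
Qed.

Let ratio_le_markov w : (g_ w / sum_ratio w * split_density w <= markov_density w)%R.
Proof.
have := markov_density_ge0 w; rewrite /sum_ratio /markov_density /split_density.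
have [->|g0] := eqVneq (g1_ w) 0%R; first by rewrite !(invr0, mulr0, mul0r).
have [->|k0] := eqVneq (k_ w) 0%R; first by rewrite !(invr0, mulr0, mul0r).
have [->|l0] := eqVneq (l_ w) 0%R; first by rewrite !(invr0, mulr0, mul0r).
have [->|r0] := eqVneq (r_ w) 0%R; first by rewrite !(invr0, mulr0, mul0r).
have [->|s0] := eqVneq (s_ w) 0%R; first by rewrite !(invr0, mulr0, mul0r).
move=> _; rewrite le_eqVlt; apply/orP; left; apply/eqP; field.
by rewrite g0 k0 l0 r0 s0.
Qed.

Variables (kX : R.-pker U ~> X) (kY : R.-pker U ~> Y).
Hypothesis HkX : cond_distribution (rvU P) (rvX P) kX.
Hypothesis HkY : cond_distribution (rvU P) (rvY P) kY.

Let Gray_Wyner_sum :=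
  mutual_info (rvXY P) (rvU P) + cond_mutual_info (rvX P) (rvXh P) (rvU P) +
    cond_mutual_info (rvY P) (rvYh P) (rvU P).

Let information_sum : Gray_Wyner_sum = \int[P]_w (log2 (sum_ratio w))%:E /\
  neg_int P (fun w => log2 (sum_ratio w)) < +oo.
Proof.
rewrite /Gray_Wyner_sum.
have [-> n1] := mutual_infoE Hg1.
have [-> n2] := cond_mutual_infoE Hk Hr HkX.
have [-> n3] := cond_mutual_infoE Hl Hs HkY.
have mV (p q : W -> R) : measurable_fun setT p -> measurable_fun setT q ->
    measurable_fun setT (fun w => p w / q w)%R.
  by move=> mp mq; apply: measurable_funM => //; exact: (measurableT_comp (@measurable_invr R)).
apply: (log_sum mg1 (mV _ _ mk mr) (mV _ _ ml ms)) => //.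
- exact: conditional_density_gt0 Hg1.
- apply: filterS2 (conditional_density_gt0 Hk) (conditional_density_gt0 Hr) => w.
  exact: divr_gt0.
- apply: filterS2 (conditional_density_gt0 Hl) (conditional_density_gt0 Hs) => w.
  exact: divr_gt0.
Qed.

Let rate_info : mutual_info (rvXY P) (rvXhYh P) = \int[P]_w (log2 (g_ w))%:E /\
  neg_int P (fun w => log2 (g_ w)) < +oo.
Proof. exact: mutual_info_swapE Hg. Qed.

(** Change of measure to the reference law, on an arbitrary event because the equality case compares
    laws event by event and not only their masses. *)
Let integral_le1 (q q' f : W -> R) :
  measurable_fun setT q -> measurable_fun setT q' -> measurable_fun setT f ->
  (forall w, (0 <= q w)%R) -> (forall w, (0 <= q' w)%R) -> (forall w, (0 <= f w)%R) ->
  (forall E, measurable E -> P E = \int[reference_of P]_(w in E) (q w)%:E) ->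
  (forall w, (f w * q w <= q' w)%R) ->
  forall E, measurable E ->
  \int[P]_(w in E) (f w)%:E <= \int[reference_of P]_(w in E) (q' w)%:E.
Proof.
move=> mq mq' mf q0 q'0 f0 PE fq E mE.
rewrite (@ge0_integral_density _ _ _ (reference_of P) (EFin \o q))//.
- apply: ge0_le_integral => //.
  + by move=> w _; rewrite -EFinM lee_fin mulr_ge0.
  + by apply: measurable_funTS; apply/measurable_EFinP; exact: measurable_funM.
  + by apply: measurable_funTS; exact/measurable_EFinP.
  + by move=> w _; rewrite -EFinM lee_fin.
- exact/measurable_EFinP.
- by rewrite [X in X < _]probability_setT ltry.
- by apply: measurable_funTS; exact/measurable_EFinP.
Qed.

Let mratio (p q : W -> R) : measurable_fun setT p -> measurable_fun setT q ->
  measurable_fun setT (fun w => p w / q w)%R.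
Proof.
by move=> mp mq; apply: measurable_funM => //; exact: (measurableT_comp (@measurable_invr R)).
Qed.

Lemma Gray_Wyner_sum_le :
  (forall E, measurable E ->
    P E = \int[reference_of P]_(w in E) (markov_density w)%:E) ->
  Gray_Wyner_sum <= mutual_info (rvXY P) (rvXhYh P).
Proof.
move=> PE; have [-> nsum] := information_sum; have [-> _] := rate_info.
apply: (gibbs_compare msum mg _ _ sum_ratio_gt0 (conditional_density_gt0 Hg) nsum _).1 => //.
rewrite -split_density_integral.
apply: (@integral_le1 markov_density) => //.
- exact: measurable_markov_density.
- exact: measurable_split_density.
- exact: mratio.
- exact: markov_density_ge0.
- exact: split_density_ge0.
- by move=> w; rewrite divr_ge0.
Qed.

Hypothesis markov_density_integral :
  \int[reference_of P]_w (markov_density w)%:E = 1.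

Lemma Gray_Wyner_sum_ge :
  (forall E, measurable E ->
    P E = \int[reference_of P]_(w in E) (split_density w)%:E) ->
  mutual_info (rvXY P) (rvXhYh P) <= Gray_Wyner_sum /\
  (Gray_Wyner_sum = mutual_info (rvXY P) (rvXhYh P) ->
   Gray_Wyner_sum \is a fin_num ->
   forall E, measurable E ->
     P E = \int[reference_of P]_(w in E) (markov_density w)%:E).
Proof.
move=> PE; have [-> nsum] := information_sum; have [-> ng] := rate_info.
have le_markov E : measurable E -> \int[P]_(w in E) (g_ w / sum_ratio w)%:E <=
    \int[reference_of P]_(w in E) (markov_density w)%:E.
  apply: (@integral_le1 split_density) => //.
  - exact: measurable_split_density.
  - exact: measurable_markov_density.
  - exact: mratio.
  - exact: split_density_ge0.
  - exact: markov_density_ge0.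
  - by move=> w; rewrite divr_ge0.
have le1 : \int[P]_w (g_ w / sum_ratio w)%:E <= 1.
  by rewrite -markov_density_integral; exact: le_markov.
have [h1 h2] := gibbs_compare mg msum g_0 sum_ratio_ge0
  (conditional_density_gt0 Hg) sum_ratio_gt0 ng le1.
split=> // e sfin; have {h2}gs := h2 e (eq_ind _ (fun x => x \is a fin_num) sfin _ e).
pose V (E : set W) := \int[reference_of P]_(w in E) (markov_density w)%:E.
(* By the equality case of Gibbs' inequality the ratio in [le_markov] is almost surely 1, so its
   integral over [E] is [P E]. *)
have PV E : measurable E -> P E <= V E.
  move=> mE; apply: le_trans (le_markov E mE).
  rewrite -[leLHS]mul1e -integral_cst//.
  rewrite (@ae_eq_integral _ _ _ P E (cst 1) (fun w => (g_ w / sum_ratio w)%:E))//.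
  - by apply: measurable_funTS; apply/measurable_EFinP; exact: mratio.
  - apply: filterS2 gs sum_ratio_gt0 => w -> sw _.
    by rewrite divff// gt_eqF.
move=> E mE; apply/eqP; rewrite eq_le PV//=.
(* Since [V] also has mass 1, the inequality on the complement of [E] gives the reverse inequality
   on [E]. *)
have VD : V E + V (~` E) = 1.
  rewrite -markov_density_integral -(setvU E) ge0_integral_setU//.
  - by rewrite addeC.
  - exact: measurableC.
  - by apply: measurable_funTS; apply/measurable_EFinP; exact: measurable_markov_density.
  - by move=> w _; rewrite lee_fin markov_density_ge0.
  - by apply/disj_set2P; rewrite setICl.
have PC := PV _ (measurableC mE).
rewrite probability_setC// in PC.
have V0 F : 0 <= V F.
  by apply: integral_ge0 => w _; rewrite lee_fin markov_density_ge0.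
have Pfin : P E \is a fin_num by exact: fin_num_measure.
rewrite -(fineK Pfin) in PC *; rewrite -[\int[_]_(w in E) _]/(V E).
move: (V0 E) (V0 (~` E)) VD PC.
case: (V E) => [a||]//; case: (V (~` E)) => [b||]// _ _.
by rewrite -EFinD -EFinB !lee_fin => -[ab] pb; lra.
Qed.

End gray_wyner_densities.

(** * The Markov conditions as a factorization of the law *)

Section markov_densities.
Context {R : realType}.
Context {dx dy du dxh dyh : measure_display}.
Context {X : measurableType dx} {Y : measurableType dy} {U : measurableType du}
  {Xh : measurableType dxh} {Yh : measurableType dyh}.
Variable P : probability (X * Y * U * Xh * Yh)%type R.
Variables (r : U * Xh -> R) (s : U * Yh -> R) (g : (Xh * Yh) * (X * Y) -> R).
Hypothesis Hr : conditional_density P (rvU P) (rvXh P) r.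
Hypothesis Hs : conditional_density P (rvU P) (rvYh P) s.
Hypothesis Hg : conditional_density P (rvXhYh P) (rvXY P) g.

Let W := (X * Y * U * Xh * Yh)%type.
Let V := (U * Xh * Yh)%type.
Let rvV : {mfun W >-> V} := rv_pair (rv_pair (rvU P) (rvXh P)) (rvYh P).
Let mu3 : probability V R :=
  reference_ubc (distribution P (rvU P)) (distribution P (rvXh P)) (distribution P (rvYh P)).
Let rs (z : V) : R := (r (z.1.1, z.1.2) * s (z.1.1, z.2))%R.

Let mr : measurable_fun setT r. Proof. by case: Hr. Qed.
Let ms : measurable_fun setT s. Proof. by case: Hs. Qed.
Let mg : measurable_fun setT g. Proof. by case: Hg. Qed.
Let r0 z : (0 <= r z)%R. Proof. by case: Hr. Qed.
Let s0 z : (0 <= s z)%R. Proof. by case: Hs. Qed.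
Let g0 z : (0 <= g z)%R. Proof. by case: Hg. Qed.

Let mrs : measurable_fun setT rs.
Proof.
apply: measurable_funM.
  by apply: (measurableT_comp mr); measurable_proj.
by apply: (measurableT_comp ms); measurable_proj.
Qed.
Let rs0 z : (0 <= rs z)%R. Proof. by rewrite mulr_ge0. Qed.
Let mrsE : measurable_fun setT (EFin \o rs). Proof. exact/measurable_EFinP. Qed.

Let integral_rs : \int[mu3]_z (rs z)%:E = 1.
Proof.
have [_ _ r1 _] := Hr; have [_ _ s1 _] := Hs.
rewrite fubini_tonelli1//.
transitivity (\int[distribution P (rvU P) \x distribution P (rvXh P)]_z (r z)%:E).
  apply: eq_integral => -[u b] _.
  rewrite -[RHS]mule1 -(s1 u) -integralM_EFin//.
  exact: (measurableT_comp ms (measurable_pair1 _)).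
rewrite fubini_tonelli1; last 2 first.
- exact/measurable_EFinP.
- by move=> z; rewrite lee_fin.
under eq_integral do rewrite /fubini_F r1.
by rewrite integral_cst// mul1e; exact: probability_setT.
Qed.

Variables (kg : R.-pker (Xh * Yh) ~> (X * Y)%type).
Hypothesis kgE : forall z F, measurable F ->
  kg z F = \int[distribution P (rvXY P)]_(a in F) (g (z, a))%:E.

Let event (F : set (X * Y)) (S : set V) := rvXY P @^-1` F `&` rvV @^-1` S.

Let measurable_event F S : measurable F -> measurable S -> measurable (event F S).
Proof. by move=> mF mS; apply: measurableI; exact: measurable_preimage_mfun. Qed.

Let mmd : measurable_fun setT (EFin \o markov_density P r s g).
Proof. by apply/measurable_EFinP; exact: (measurable_markov_density Hr Hs Hg). Qed.

Let mkg F : measurable F -> measurable_fun setT (fun z : V => kg (z.1.2, z.2) F).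
Proof.
move=> mF; apply: (@measurableT_comp _ _ _ _ _ _ (kg ^~ F) _ (fun z : V => (z.1.2, z.2))).
  exact: measurable_kernel.
by measurable_proj.
Qed.

(** Integrating over (X, Y) first turns the factor [g] into [kg], and what remains involves only (U,
    Xh, Yh). *)
Let integral_event F S : measurable F -> measurable S ->
  \int[reference_of P]_(w in event F S) (markov_density P r s g w)%:E =
  \int[mu3]_(z in S) (kg (z.1.2, z.2) F * (rs z)%:E).
Proof.
move=> mF mS; rewrite integral_mkcond integral_reference2; last 2 first.
- apply/(measurable_restrictT _ _).1; first exact: measurable_event.
  exact: measurable_funTS.
- move=> w; apply: erestrict_ge0 => w' _; rewrite lee_fin; exact: (markov_density_ge0 Hr Hs Hg).
rewrite [RHS]integral_mkcond; apply: eq_integral => -[[u b] c] _ /=.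
rewrite patchE; case: ifPn => zS; last first.
  rewrite integral0_eq// => a _; rewrite patchE ifF//.
  by apply/negbTE; apply: contra zS => /set_mem[_ ?]; exact/mem_set.
have mgF : measurable_fun F (fun a => (g ((b, c), a))%:E).
  apply: measurable_funTS.
  by apply/measurable_EFinP; exact: (measurableT_comp mg (measurable_pair1 _)).
rewrite kgE//= muleC -ge0_integralZl_EFin//; last first.
  by move=> a _; rewrite lee_fin.
rewrite [RHS]integral_mkcond.
apply: eq_integral => -[x y] _; rewrite !patchE.
have -> : ((x, y, u, b, c) \in event F S) = ((x, y) \in F).
  by apply/idP/idP => /set_mem => [[]? _|Fa]; apply/mem_set => //; split => //; exact: set_mem.
by case: ifP => _; rewrite // -EFinM mulrC.
Qed.

(** Under this density (Xh, Yh) need not have its law under [P], so it is the normalization of [g]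
    at every point that counts. *)
Lemma markov_density_integral :
  \int[reference_of P]_w (markov_density P r s g w)%:E = 1.
Proof.
have <- : event setT setT = setT by apply/seteqP.
rewrite integral_event// -integral_rs; apply: eq_integral => z _.
rewrite kgE//; case: Hg => _ _ -> _; exact: mul1e.
Qed.

(** The law of (U, Xh, Yh) is P(U) P(Xh|U) P(Yh|U); by [markov_UP] this is the first Markov
    condition. *)
Let law_uhh := forall S, measurable S ->
  P (rvV @^-1` S) = \int[mu3]_(z in S) (rs z)%:E.

Let integral_law_uhh : law_uhh -> forall S (f : V -> \bar R), measurable S ->
  measurable_fun setT f -> (forall z, 0 <= f z) ->
  \int[P]_(w in rvV @^-1` S) f (rvV w) = \int[mu3]_(z in S) (f z * (rs z)%:E).
Proof.
move=> PS S f mS mf f0.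
rewrite -(@ge0_integral_density _ _ _ mu3 (EFin \o rs) _ _ (distribution P rvV))//.
- by rewrite [RHS]ge0_integral_pushforward//; exact: measurable_funTS.
- by rewrite [X in X < _]probability_setT ltry.
- exact: measurable_funTS.
Qed.

Variables (kr : R.-pker U ~> Xh) (ks : R.-pker U ~> Yh) (kt : R.-pker (Xh * Yh) ~> U).
Hypothesis krE : forall z F, measurable F ->
  kr z F = \int[distribution P (rvXh P)]_(b in F) (r (z, b))%:E.
Hypothesis ksE : forall z F, measurable F ->
  ks z F = \int[distribution P (rvYh P)]_(c in F) (s (z, c))%:E.
Hypothesis Hkr : cond_distribution (rvU P) (rvXh P) kr.
Hypothesis Hks : cond_distribution (rvU P) (rvYh P) ks.
Hypothesis Hkg : cond_distribution (rvXhYh P) (rvXY P) kg.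
Hypothesis Hkt : cond_distribution (rvXhYh P) (rvU P) kt.

Let integral_box E F H : measurable E -> measurable F -> measurable H ->
  \int[mu3]_(z in E `*` F `*` H) (rs z)%:E =
  \int[P]_(w in rvU P @^-1` E) (kr (rvU P w) F * ks (rvU P w) H).
Proof.
move=> mE mF mH.
have mEFH : measurable (E `*` F `*` H) by apply: measurableX => //; exact: measurableX.
rewrite integral_mkcond fubini_tonelli1; last 2 first.
- by apply/(measurable_restrictT _ _).1 => //; exact: measurable_funTS.
- by move=> z; apply: erestrict_ge0 => z' _; rewrite lee_fin.
transitivity (\int[distribution P (rvU P) \x distribution P (rvXh P)]_(z in E `*` F)
   ((r z)%:E * ks z.1 H)).
  rewrite [RHS]integral_mkcond; apply: eq_integral => -[u b] _.
  rewrite /fubini_F patchE; case: ifPn => ub; last first.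
    by rewrite integral0_eq// => c _; rewrite patchE in_setX (negPf ub).
  rewrite ksE// -ge0_integralZl_EFin//; last 2 first.
  - by move=> a _; rewrite lee_fin.
  - apply: measurable_funTS.
    by apply/measurable_EFinP; exact: (measurableT_comp ms (measurable_pair1 _)).
  rewrite [RHS]integral_mkcond.
  apply: eq_integral => c _; rewrite !patchE in_setX ub/=.
  by case: ifP => _; rewrite // -EFinM.
have mks : measurable_fun setT (fun u => ks u H) by exact: measurable_kernel.
have mrks : measurable_fun setT (fun z => (r z)%:E * ks z.1 H).
  apply: emeasurable_funM; first exact/measurable_EFinP.
  exact: (measurableT_comp mks measurable_fst).
rewrite integral_mkcond fubini_tonelli1; last 2 first.
- apply/(measurable_restrictT _ _).1; first exact: measurableX.
  exact: measurable_funTS.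
- by move=> z; apply: erestrict_ge0 => z' _; rewrite mule_ge0// lee_fin.
transitivity (\int[distribution P (rvU P)]_(u in E) (kr u F * ks u H)).
  rewrite [RHS]integral_mkcond; apply: eq_integral => u _.
  rewrite /fubini_F patchE; case: ifPn => uE; last first.
    by rewrite integral0_eq// => b _; rewrite patchE in_setX (negPf uE).
  rewrite krE// -ge0_integralZr//; last 2 first.
  - apply: measurable_funTS.
    by apply/measurable_EFinP; exact: (measurableT_comp mr (measurable_pair1 _)).
  - by move=> a _; rewrite lee_fin.
  rewrite [RHS]integral_mkcond.
  apply: eq_integral => b _; rewrite !patchE in_setX uE/=.
  by [].
rewrite [LHS]ge0_integral_pushforward//.
by apply: measurable_funTS; apply: emeasurable_funM => //; exact: measurable_kernel.
Qed.

Let markov_UP : markov_chain (rvXh P) (rvU P) (rvYh P) <-> law_uhh.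
Proof.
have h E F H : measurable E -> measurable F -> measurable H ->
    \int[P]_(w in rvU P @^-1` E `&` rvYh P @^-1` H) kr (rvU P w) F =
    \int[mu3]_(z in E `*` F `*` H) (rs z)%:E.
  move=> mE mF mH; rewrite integral_box//.
  by rewrite (cond_distribution_integral Hks (psi := fun u => kr u F))//; exact: measurable_kernel.
have VE E F H : rvV @^-1` (E `*` F `*` H) =
    rvXh P @^-1` F `&` rvU P @^-1` E `&` rvYh P @^-1` H.
  by apply/seteqP; split => w /=; tauto.
split=> [/(markov_chainP Hkr Hks) M S mS|law].
  have [Q QE] := density_probability mrsE (fun z => rs0 z) integral_rs.
  rewrite -QE//; apply: (@box3_unique _ _ _ _ _ _ _ (distribution P rvV) Q) => //.
    by rewrite [X in X < _]probability_setT ltry.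
  move=> E F H mE mF mH; rewrite [RHS]QE; last by apply: measurableX => //; exact: measurableX.
  by rewrite -h// -M//= -VE.
apply/(markov_chainP Hkr Hks) => F E H mF mE mH.
by rewrite h// -VE law//; apply: measurableX => //; exact: measurableX.
Qed.

(** Given [law], averaging [kg] over an event of (Xh, Yh, U) amounts to integrating
    [markov_density], so the second Markov condition says that [P] has this density on boxes. *)
Let markov_XYP (law : law_uhh) : markov_chain (rvXY P) (rvXhYh P) (rvU P) <->
  forall F G E, measurable F -> measurable G -> measurable E ->
    P (rvXY P @^-1` F `&` rvXhYh P @^-1` G `&` rvU P @^-1` E) =
    \int[reference_of P]_(w in event F [set z | G (z.1.2, z.2) /\ E z.1.1])
       (markov_density P r s g w)%:E.
Proof.
have h F G E : measurable F -> measurable G -> measurable E ->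
    \int[P]_(w in rvXhYh P @^-1` G `&` rvU P @^-1` E) kg (rvXhYh P w) F =
    \int[reference_of P]_(w in event F [set z | G (z.1.2, z.2) /\ E z.1.1])
       (markov_density P r s g w)%:E.
  move=> mF mG mE; pose S := [set z : V | G (z.1.2, z.2) /\ E z.1.1].
  have mS : measurable S.
    apply: measurableI; rewrite -[X in measurable X]setTI.
      by apply: (_ : measurable_fun setT (fun z : V => (z.1.2, z.2))) => //; measurable_proj.
    by apply: (_ : measurable_fun setT (fun z : V => z.1.1)) => //; measurable_proj.
  rewrite integral_event// -(integral_law_uhh law mS (f := fun z => kg (z.1.2, z.2) F))//.
  exact: mkg.
split=> [/(markov_chainP Hkg Hkt) M F G E mF mG mE|M].
  by rewrite M// h.
by apply/(markov_chainP Hkg Hkt) => F G E mF mG mE; rewrite M// h.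
Qed.

Lemma markov_densityP :
  (markov_chain (rvXh P) (rvU P) (rvYh P) /\
   markov_chain (rvXY P) (rvXhYh P) (rvU P)) <->
  forall E, measurable E ->
    P E = \int[reference_of P]_(w in E) (markov_density P r s g w)%:E.
Proof.
split=> [[/markov_UP law /(markov_XYP law) M] D mD|PE].
  have [Q QE] := density_probability mmd
    (fun w => markov_density_ge0 Hr Hs Hg w : 0 <= (markov_density P r s g w)%:E)
    markov_density_integral.
  rewrite -QE//; apply: box4_unique => //.
    by rewrite [X in X < _]probability_setT ltry.
  move=> F E G H mF mE mG mH.
  have mB : measurable (F `*` E `*` G `*` H).
    by do 2!(apply: measurableX => //); exact: measurableX.
  rewrite [RHS]QE//; have := M F (G `*` H) E mF (measurableX mG mH) mE.
  have -> : rvXY P @^-1` F `&` rvXhYh P @^-1` (G `*` H) `&` rvU P @^-1` E =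
      F `*` E `*` G `*` H.
    by rewrite rvXYE; apply/seteqP; split => w /=; tauto.
  move=> h; rewrite [LHS]h; congr (\int[_]_(w in _) _).
  by rewrite /event rvXYE; apply/seteqP; split => w /=; tauto.
(* In the converse direction (X, Y) is integrated out of the density first, since the second Markov
   condition is characterized only under [law_uhh]. *)
have law : law_uhh.
  move=> S mS; have -> : rvV @^-1` S = event setT S by rewrite /event preimage_setT setTI.
  rewrite PE; last exact: measurable_event.
  rewrite integral_event//; apply: eq_integral => z _.
  by rewrite kgE//; case: Hg => _ _ -> _; exact: mul1e.
split; first exact/markov_UP.
apply/(markov_XYP law) => F G E mF mG mE; rewrite PE.
  congr (\int[_]_(w in _) _).
  by apply/seteqP; split => w; rewrite /event/=; tauto.
by apply: measurableI; [apply: measurableI|]; exact: measurable_preimage_mfun.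
Qed.

End markov_densities.

(** * Transfer between laws with common marginals *)

Section law_transfer.
Context d ds dt (W : measurableType d) (S : measurableType ds)
  (T : measurableType dt) (R : realType).

Lemma product_measure_ext (m1 n1 : probability S R) (m2 n2 : probability T R) :
  (forall E, measurable E -> m1 E = n1 E) ->
  (forall F, measurable F -> m2 F = n2 F) ->
  forall E, measurable E -> (m1 \x m2) E = (n1 \x n2) E.
Proof.
move=> h1 h2; apply: box2_unique.
  by rewrite [X in X < _](@probability_setT _ _ _ (m1 \x m2 : probability _ R)) ltry.
move=> E F mE mF; rewrite [LHS]product_measure1E// [RHS]product_measure1E//.
by rewrite [X in X * _ = _]h1// [X in _ * X = _]h2.
Qed.

Variables P Q : probability W R.

Lemma conditional_density_transfer (f : {mfun W >-> S}) (g : {mfun W >-> T})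
    (k : S * T -> R) :
  (forall E, measurable E ->
    distribution Q (rv_pair f g) E = distribution P (rv_pair f g) E) ->
  conditional_density P f g k -> conditional_density Q f g k.
Proof.
move=> QP [mk k0 k1 kE].
have hf E : measurable E -> distribution Q f E = distribution P f E.
  move=> mE; have := QP (E `*` setT) (measurableX mE measurableT).
  have h (M : probability W R) : distribution M (rv_pair f g) (E `*` setT) = distribution M f E.
    by rewrite /distribution /pushforward; congr (M _); apply/seteqP; split => w //= [].
  by rewrite !h.
have hg F : measurable F -> distribution Q g F = distribution P g F.
  move=> mF; have := QP (setT `*` F) (measurableX measurableT mF).
  have h (M : probability W R) : distribution M (rv_pair f g) (setT `*` F) = distribution M g F.
    by rewrite /distribution /pushforward; congr (M _); apply/seteqP; split => w //= [].
  by rewrite !h.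
split=> // [s|E mE].
  by rewrite -(k1 s); apply: eq_measure_integral => F mF _; exact: hg.
rewrite QP// kE//; apply: eq_measure_integral => F mF _.
by apply: product_measure_ext => // G mG; apply/esym; [exact: hf|exact: hg].
Qed.

Lemma integral_transfer (f : {mfun W >-> S}) (F : S -> R) :
  (forall E, measurable E -> distribution Q f E = distribution P f E) ->
  measurable_fun setT F -> \int[Q]_w (F (f w))%:E = \int[P]_w (F (f w))%:E.
Proof.
move=> QP mF; rewrite -(integral_distribution_real Q f mF).1.
rewrite -(integral_distribution_real P f mF).1.
by apply: eq_measure_integral => E mE _; exact: QP.
Qed.

End law_transfer.

Lemma law_of_integral d ds (W : measurableType d) (S : measurableType ds)
    (R : realType) (P Q : probability W R) (f : {mfun W >-> S}) :
  (forall h : S -> \bar R, measurable_fun setT h -> (forall z, 0 <= h z) ->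
    \int[Q]_w h (f w) = \int[P]_w h (f w)) ->
  forall E, measurable E -> distribution Q f E = distribution P f E.
Proof.
move=> QP E mE; pose h := (cst 1%E : S -> \bar R) \_ E.
have hE (M : probability W R) : distribution M f E = \int[M]_w h (f w).
  rewrite -[LHS]mul1e -(integral_cst M (measurable_preimage_mfun f mE)).
  by rewrite [LHS]integral_mkcond; apply: eq_integral => w _; rewrite /h !patchE (in_preimage f E w).
rewrite !hE; apply: QP; last by move=> z; exact: erestrict_ge0.
by apply/(measurable_restrictT _ _).1 => //; exact: measurable_cst.
Qed.

Section iterated_integrals.
Context db dc (B : measurableType db) (C : measurableType dc) (R : realType).
Variables (pb : probability B R) (pc : probability C R).
Variables (q : R) (k : B -> R) (l : C -> R).
Hypotheses (q0 : (0 <= q)%R) (k0 : forall b, (0 <= k b)%R) (l0 : forall c, (0 <= l c)%R).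
Hypotheses (mk : measurable_fun setT k) (ml : measurable_fun setT l).
Hypotheses (k1 : \int[pb]_b (k b)%:E = 1) (l1 : \int[pc]_c (l c)%:E = 1).

Let mkE : measurable_fun setT (EFin \o k). Proof. exact/measurable_EFinP. Qed.
Let mlE : measurable_fun setT (EFin \o l). Proof. exact/measurable_EFinP. Qed.

Lemma iterated_integral_fst (h : B -> \bar R) :
  measurable_fun setT h -> (forall b, 0 <= h b) ->
  \int[pb]_b \int[pc]_c (h b * (q * (k b * l c))%:E) =
  q%:E * \int[pb]_b (h b * (k b)%:E).
Proof.
move=> mh h0; rewrite -ge0_integralZl_EFin//; last 2 first.
- by move=> b _; rewrite mule_ge0// lee_fin.
- exact: emeasurable_funM.
apply: eq_integral => b _.
transitivity (\int[pc]_c ((q%:E * (h b * (k b)%:E)) * (l c)%:E)).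
  by apply: eq_integral => c _; rewrite !EFinM !muleA (muleC q%:E).
rewrite ge0_integralZl//; first by rewrite l1 mule1.
  by move=> c _; rewrite lee_fin.
by rewrite !mule_ge0 ?lee_fin.
Qed.

Lemma iterated_integral_snd (h : C -> \bar R) :
  measurable_fun setT h -> (forall c, 0 <= h c) ->
  \int[pb]_b \int[pc]_c (h c * (q * (k b * l c))%:E) =
  q%:E * \int[pc]_c (h c * (l c)%:E).
Proof.
move=> mh h0; set I := \int[pc]_c _.
have I0 : 0 <= I by apply: integral_ge0 => c _; rewrite mule_ge0// lee_fin.
transitivity (\int[pb]_b ((k b)%:E * (q%:E * I))).
  apply: eq_integral => b _.
  transitivity (\int[pc]_c (((k b)%:E * q%:E) * (h c * (l c)%:E))).
    apply: eq_integral => c _; rewrite !EFinM !muleA; congr (_ * _).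
    by rewrite muleC (muleC (h c)) muleA.
  rewrite ge0_integralZl// ?muleA//; first exact: emeasurable_funM.
    by move=> c _; rewrite mule_ge0// lee_fin.
  by rewrite mule_ge0// lee_fin.
rewrite ge0_integralZr//; first by rewrite k1 mul1e.
  by move=> b _; rewrite lee_fin.
by rewrite mule_ge0// lee_fin.
Qed.

End iterated_integrals.

(** * The two bounds on the sum of the rates *)

Section gray_wyner_bounds.
Context {R : realType}.
Context {dx dy du dxh dyh : measure_display}.
Context {X : measurableType dx} {Y : measurableType dy} {U : measurableType du}
  {Xh : measurableType dxh} {Yh : measurableType dyh}.
Let W := (X * Y * U * Xh * Yh)%type.

Definition Gray_Wyner_sum (P : probability W R) :=
  mutual_info (rvXY P) (rvU P) + cond_mutual_info (rvX P) (rvXh P) (rvU P) +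
    cond_mutual_info (rvY P) (rvYh P) (rvU P).

Lemma markov_Gray_Wyner_sum_le (P : probability W R) : has_joint_density P ->
  markov_chain (rvXh P) (rvU P) (rvYh P) ->
  markov_chain (rvXY P) (rvXhYh P) (rvU P) ->
  Gray_Wyner_sum P <= mutual_info (rvXY P) (rvXhYh P).
Proof.
move=> /joint_density_dominated[Pref _] M1 M2.
have [g1 Hg1] := density_U_given_XY Pref.
have [k Hk] := density_Xh_given_XU Pref.
have [l Hl] := density_Yh_given_YU Pref.
have [r Hr] := density_Xh_given_U Pref.
have [s Hs] := density_Yh_given_U Pref.
have [g Hg] := density_XY_given_XhYh Pref.
have [t Ht] := density_U_given_XhYh Pref.
have [qX HqX] := density_X_given_U Pref.
have [qY HqY] := density_Y_given_U Pref.
have [kX [_ HkX]] := conditional_density_kernel HqX.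
have [kY [_ HkY]] := conditional_density_kernel HqY.
have [kr [krE Hkr]] := conditional_density_kernel Hr.
have [ks [ksE Hks]] := conditional_density_kernel Hs.
have [kg [kgE Hkg]] := conditional_density_kernel Hg.
have [kt [_ Hkt]] := conditional_density_kernel Ht.
apply: (Gray_Wyner_sum_le Hg1 Hk Hl Hr Hs Hg HkX HkY).
by apply/(markov_densityP Hr Hs Hg kgE krE ksE Hkr Hks Hkg Hkt).
Qed.

(** [Q] has density [split_density]. Each rate and each distortion depends on one of the triples
    (X,Y,U), (X,U,Xh), (Y,U,Yh), whose laws are kept. Agreement is stated for integrals, which gives
    both the laws and the expected distortions. *)
Lemma Gray_Wyner_sum_split (P : probability W R) : has_joint_density P ->
  exists Q : probability W R,
  [/\ has_joint_density Q,
      forall h : X * Y * U -> \bar R, measurable_fun setT h -> (forall z, 0 <= h z) ->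
        \int[Q]_w h (rvXY Q w, rvU Q w) = \int[P]_w h (rvXY P w, rvU P w),
      forall h : X * U * Xh -> \bar R, measurable_fun setT h -> (forall z, 0 <= h z) ->
        \int[Q]_w h (rvX Q w, rvU Q w, rvXh Q w) =
        \int[P]_w h (rvX P w, rvU P w, rvXh P w) &
      forall h : Y * U * Yh -> \bar R, measurable_fun setT h -> (forall z, 0 <= h z) ->
        \int[Q]_w h (rvY Q w, rvU Q w, rvYh Q w) =
        \int[P]_w h (rvY P w, rvU P w, rvYh P w)] /\
  [/\ mutual_info (rvXY Q) (rvU Q) = mutual_info (rvXY P) (rvU P),
      cond_mutual_info (rvX Q) (rvXh Q) (rvU Q) =
        cond_mutual_info (rvX P) (rvXh P) (rvU P) &
      cond_mutual_info (rvY Q) (rvYh Q) (rvU Q) =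
        cond_mutual_info (rvY P) (rvYh P) (rvU P)] /\
  mutual_info (rvXY Q) (rvXhYh Q) <= Gray_Wyner_sum Q /\
  (Gray_Wyner_sum Q = mutual_info (rvXY Q) (rvXhYh Q) ->
   Gray_Wyner_sum Q \is a fin_num ->
   markov_chain (rvXh Q) (rvU Q) (rvYh Q) /\
   markov_chain (rvXY Q) (rvXhYh Q) (rvU Q)).
Proof.
move=> dP; have [Pref densities] := joint_density_dominated dP.
have [g1 Hg1] := density_U_given_XY Pref.
have [k Hk] := density_Xh_given_XU Pref.
have [l Hl] := density_Yh_given_YU Pref.
have [r Hr] := density_Xh_given_U Pref.
have [s Hs] := density_Yh_given_U Pref.
have [qX HqX] := density_X_given_U Pref.
have [qY HqY] := density_Y_given_U Pref.
have [kX [_ HkX]] := conditional_density_kernel HqX.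
have [kY [_ HkY]] := conditional_density_kernel HqY.
have [mg1 g10 g11 g1E] := Hg1.
have [mk k0 k1 _] := Hk.
have [ml l0 l1 _] := Hl.
have [mr r0 _ _] := Hr.
have [ms s0 _ _] := Hs.
pose sd := split_density P g1 k l.
have msd : measurable_fun setT sd by exact: (measurable_split_density Hg1 Hk Hl).
have sd0 w : (0 <= sd w)%R by exact: (split_density_ge0 Hg1 Hk Hl).
have msdE : measurable_fun setT (EFin \o sd) by exact/measurable_EFinP.
have [Q QE] := @density_probability _ _ _ (reference_of P) _ msdE
  (fun w => sd0 w : 0 <= (sd w)%:E) (split_density_integral Hg1 Hk Hl).
pose a := distribution P (rvXY P); pose nu := distribution P (rvU P).
have mproj d1 (T : measurableType d1) (h : T -> \bar R) (f : W -> T) :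
    measurable_fun setT h -> measurable_fun setT f -> measurable_fun setT (fun w => h (f w)).
  by move=> mh mf; exact: (measurableT_comp mh mf).
have QI h : measurable_fun setT h -> (forall w, 0 <= h w) ->
    \int[Q]_w h w = \int[a \x nu]_z \int[distribution P (rvXh P)]_b
      \int[distribution P (rvYh P)]_c (h (z, b, c) * (sd (z, b, c))%:E).
  move=> mh h0; rewrite (@ge0_integral_density _ _ _ (reference_of P) (EFin \o sd))//.
  - rewrite integral_reference1//; first exact: emeasurable_funM.
    by move=> w; rewrite mule_ge0// lee_fin.
  - by rewrite [X in X < _]probability_setT ltry.
have PI h : measurable_fun setT h -> (forall z, 0 <= h z) ->
    \int[P]_w h (rvXY P w, rvU P w) = \int[a \x nu]_z (h z * (g1 z)%:E).
  move=> mh h0; rewrite -(ge0_integral_distribution (rv_pair (rvXY P) (rvU P) : {RV P >-> _}) mh h0).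
  apply: (@ge0_integral_density _ _ _ (a \x nu : probability _ R) (EFin \o g1)) => //.
  - exact/measurable_EFinP.
  - by rewrite [X in X < _]probability_setT ltry.
have mpair d1 d2 (S : measurableType d1) (T : measurableType d2) (q : S * T -> R) z :
    measurable_fun setT q -> measurable_fun setT (fun t => q (z, t)).
  by move=> mq; exact: (measurableT_comp mq (measurable_pair1 _)).
have mpairE d1 d2 (S : measurableType d1) (T : measurableType d2) (q : S * T -> \bar R) z :
    measurable_fun setT q -> measurable_fun setT (fun t => q (z, t)).
  by move=> mq; exact: (measurableT_comp mq (measurable_pair1 _)).
have QX h : measurable_fun setT h -> (forall z, 0 <= h z) ->
    \int[Q]_w h (rvX Q w, rvU Q w, rvXh Q w) = \int[P]_w h (rvX P w, rvU P w, rvXh P w).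
  move=> mh h0.
  pose f (z : X * Y * U) := \int[distribution P (rvXh P)]_b
    (h (z.1.1, z.2, b) * (k (z.1.1, z.2, b))%:E).
  have mhk : measurable_fun setT (fun z => h z * (k z)%:E).
    by apply: emeasurable_funM => //; exact/measurable_EFinP.
  have mf : measurable_fun setT f.
    apply: (@measurableT_comp _ _ _ _ _ _
      (fubini_F (distribution P (rvXh P)) (fun z => h z * (k z)%:E)) _ (fun z : X * Y * U => (z.1.1, z.2))).
      apply: measurable_fun_fubini_tonelli_F => //.
      by move=> z; rewrite mule_ge0// lee_fin.
    by measurable_proj.
  have f0 z : 0 <= f z.
    by apply: integral_ge0 => b _; rewrite mule_ge0// lee_fin.
  rewrite (conditional_density_integral Hk mh h0) [RHS](PI f)// QI//; last first.
    by apply: (measurableT_comp mh); measurable_proj.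
  apply: eq_integral => -[[x y] u] _; rewrite muleC /f/=.
  apply: (@iterated_integral_fst _ _ _ _ _ _ _ (g1 (x, y, u)) (fun b => k (x, u, b))
    (fun c => l (y, u, c)) _ _ _ _ _ _ (fun b => h (x, u, b))) => //;
  (exact: mpair || exact: mpairE || exact: k1 || exact: l1).
have QY h : measurable_fun setT h -> (forall z, 0 <= h z) ->
    \int[Q]_w h (rvY Q w, rvU Q w, rvYh Q w) = \int[P]_w h (rvY P w, rvU P w, rvYh P w).
  move=> mh h0.
  pose f (z : X * Y * U) := \int[distribution P (rvYh P)]_c
    (h (z.1.2, z.2, c) * (l (z.1.2, z.2, c))%:E).
  have mhl : measurable_fun setT (fun z => h z * (l z)%:E).
    by apply: emeasurable_funM => //; exact/measurable_EFinP.
  have mf : measurable_fun setT f.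
    apply: (@measurableT_comp _ _ _ _ _ _
      (fubini_F (distribution P (rvYh P)) (fun z => h z * (l z)%:E)) _ (fun z : X * Y * U => (z.1.2, z.2))).
      apply: measurable_fun_fubini_tonelli_F => //.
      by move=> z; rewrite mule_ge0// lee_fin.
    by measurable_proj.
  have f0 z : 0 <= f z.
    by apply: integral_ge0 => b _; rewrite mule_ge0// lee_fin.
  rewrite (conditional_density_integral Hl mh h0) [RHS](PI f)// QI//; last first.
    by apply: (measurableT_comp mh); measurable_proj.
  apply: eq_integral => -[[x y] u] _; rewrite muleC /f/=.
  apply: (@iterated_integral_snd _ _ _ _ _ _ _ (g1 (x, y, u)) (fun b => k (x, u, b))
    (fun c => l (y, u, c)) _ _ _ _ _ _ (fun c => h (y, u, c))) => //;
  (exact: mpair || exact: mpairE || exact: k1 || exact: l1).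
have QXYU h : measurable_fun setT h -> (forall z, 0 <= h z) ->
    \int[Q]_w h (rvXY Q w, rvU Q w) = \int[P]_w h (rvXY P w, rvU P w).
  move=> mh h0; rewrite PI// QI//; last first.
    apply: (measurableT_comp mh).
    by apply: measurable_fun_pair; exact: measurable_funP.
  apply: eq_integral => -[[x y] u] _.
  transitivity ((g1 (x, y, u))%:E * \int[distribution P (rvXh P)]_b
     (h (x, y, u) * (k (x, u, b))%:E)).
    apply: (@iterated_integral_fst _ _ _ _ _ _ _ (g1 (x, y, u)) (fun b => k (x, u, b))
      (fun c => l (y, u, c)) _ _ _ _ _ _ (fun b => h (x, y, u))) => //;
    (exact: mpair || exact: mpairE || exact: k1 || exact: l1).
  rewrite ge0_integralZl//; first by rewrite k1 mule1 muleC.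
    by apply/measurable_EFinP; exact: mpair.
  by move=> b _; rewrite lee_fin.
have lawXYU := @law_of_integral _ _ _ _ _ P Q (rv_pair (rvXY P) (rvU P)) QXYU.
have lawX := @law_of_integral _ _ _ _ _ P Q (rv_pair (rv_pair (rvX P) (rvU P)) (rvXh P)) QX.
have lawY := @law_of_integral _ _ _ _ _ P Q (rv_pair (rv_pair (rvY P) (rvU P)) (rvYh P)) QY.
have QUXh h : measurable_fun setT h -> (forall z, 0 <= h z) ->
    \int[Q]_w h (rvU Q w, rvXh Q w) = \int[P]_w h (rvU P w, rvXh P w).
  move=> mh h0; apply: (QX (fun z => h (z.1.2, z.2))) => //.
  by apply: (measurableT_comp mh); measurable_proj.
have QUYh h : measurable_fun setT h -> (forall z, 0 <= h z) ->
    \int[Q]_w h (rvU Q w, rvYh Q w) = \int[P]_w h (rvU P w, rvYh P w).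
  move=> mh h0; apply: (QY (fun z => h (z.1.2, z.2))) => //.
  by apply: (measurableT_comp mh); measurable_proj.
have lawUXh := @law_of_integral _ _ _ _ _ P Q (rv_pair (rvU P) (rvXh P)) QUXh.
have lawUYh := @law_of_integral _ _ _ _ _ P Q (rv_pair (rvU P) (rvYh P)) QUYh.
(* The five densities involve only the kept marginals, so they remain conditional densities under
   [Q]; with equal reference laws, [Q] is its own split law, as [Gray_Wyner_sum_ge] requires. *)
have Hg1' : conditional_density Q (rvXY Q) (rvU Q) g1 := conditional_density_transfer lawXYU Hg1.
have Hk' : conditional_density Q (rv_pair (rvX Q) (rvU Q)) (rvXh Q) k :=
  conditional_density_transfer lawX Hk.
have Hl' : conditional_density Q (rv_pair (rvY Q) (rvU Q)) (rvYh Q) l :=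
  conditional_density_transfer lawY Hl.
have Hr' : conditional_density Q (rvU Q) (rvXh Q) r := conditional_density_transfer lawUXh Hr.
have Hs' : conditional_density Q (rvU Q) (rvYh Q) s := conditional_density_transfer lawUYh Hs.
have refE E : measurable E -> reference_of Q E = reference_of P E.
  apply: product_measure_ext => [D mD|D mD]; last first.
    apply: (@law_of_integral _ _ _ _ _ P Q (rvYh P)) => // h mh h0.
    apply: (QUYh (fun z => h z.2)) => //.
    exact: (measurableT_comp mh measurable_snd).
  apply: product_measure_ext mD => [D' mD'|D' mD']; last first.
    apply: (@law_of_integral _ _ _ _ _ P Q (rvXh P)) => // h mh h0.
    apply: (QUXh (fun z => h z.2)) => //.
    exact: (measurableT_comp mh measurable_snd).
  apply: product_measure_ext mD' => F mF.
    apply: (@law_of_integral _ _ _ _ _ P Q (rvXY P)) => // h mh h0.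
    apply: (QXYU (fun z => h z.1)) => //.
    exact: (measurableT_comp mh measurable_fst).
  apply: (@law_of_integral _ _ _ _ _ P Q (rvU P)) => // h mh h0.
  apply: (QXYU (fun z => h z.2)) => //.
  exact: (measurableT_comp mh measurable_snd).
have Qref0 : Q `<< reference_of P.
  apply/null_content_dominatesP => E mE E0; rewrite QE//.
  by rewrite null_set_integral//; exact: measurable_funTS.
have Qref : Q `<< reference_of Q.
  apply: (null_dominates_trans Qref0).
  by apply/null_content_dominatesP => E mE E0; rewrite -refE.
have QE' E : measurable E ->
    Q E = \int[reference_of Q]_(w in E) (split_density Q g1 k l w)%:E.
  move=> mE; have -> : split_density Q g1 k l = sd by [].
  have h F : measurable F -> F `<=` E -> reference_of Q F = reference_of P F.
    by move=> mF _; exact: refE.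
  rewrite (QE E mE).
  exact/esym/(@eq_measure_integral _ _ _ E (reference_of P) (reference_of Q) (EFin \o sd) h).
have [qX' HqX'] := density_X_given_U Qref.
have [qY' HqY'] := density_Y_given_U Qref.
have [kX' [_ HkX']] := conditional_density_kernel HqX'.
have [kY' [_ HkY']] := conditional_density_kernel HqY'.
(* The law of (X, Y, Xh, Yh) is not kept in general, so this density has to be taken under [Q]. *)
have [g Hg] := density_XY_given_XhYh Qref.
have [t Ht] := density_U_given_XhYh Qref.
have [kr [krE Hkr]] := conditional_density_kernel Hr'.
have [ks [ksE Hks]] := conditional_density_kernel Hs'.
have [kg [kgE Hkg]] := conditional_density_kernel Hg.
have [kt [_ Hkt]] := conditional_density_kernel Ht.
exists Q; split; first by split => //; exact: densities.
have mratio d1 (T : measurableType d1) (p q : T -> R) :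
    measurable_fun setT p -> measurable_fun setT q ->
    measurable_fun setT (fun w => log2 (p w / q w)%R).
  move=> mp mq; apply: (measurableT_comp (@measurable_log2 R)).
  by apply: measurable_funM => //; exact: (measurableT_comp (@measurable_invr R)).
split.
  split.
  - rewrite (mutual_infoE Hg1').1 (mutual_infoE Hg1).1.
    apply: (integral_transfer (F := fun z => log2 (g1 z)) lawXYU).
    exact: (measurableT_comp (@measurable_log2 R)).
  - rewrite (cond_mutual_infoE Hk' Hr' HkX').1 (cond_mutual_infoE Hk Hr HkX).1.
    apply: (integral_transfer (F := fun z => log2 (k z / r (z.1.2, z.2))%R) lawX).
    by apply: mratio => //; apply: (measurableT_comp mr); measurable_proj.
  - rewrite (cond_mutual_infoE Hl' Hs' HkY').1 (cond_mutual_infoE Hl Hs HkY).1.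
    apply: (integral_transfer (F := fun z => log2 (l z / s (z.1.2, z.2))%R) lawY).
    by apply: mratio => //; apply: (measurableT_comp ms); measurable_proj.
have [le_sum sum_eq] := Gray_Wyner_sum_ge Hg1' Hk' Hl' Hr' Hs' Hg HkX' HkY'
  (markov_density_integral Hr' Hs' Hg kgE) QE'.
split=> // e efin.
apply/(markov_densityP Hr' Hs' Hg kgE krE ksE Hkr Hks Hkg Hkt).
exact: sum_eq.
Qed.

End gray_wyner_bounds.

(** * Approximate and exact points of the Pangloss plane *)

Section closure_rd_tuple.
Context {R : realType}.

Lemma closure_rd_tupleP (S : set (rd_tuple R)) (a b c d e : R) :
  closure S (a, b, c, d, e) <->
  forall eps : R, (0 < eps)%R -> exists a' b' c' d' e' : R,
    S (a', b', c', d', e') /\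
    [/\ `|a - a'| < eps, `|b - b'| < eps & `|c - c'| < eps]%R /\
    (`|d - d'| < eps /\ `|e - e'| < eps)%R.
Proof.
split=> [clS eps eps0|h B].
  have [[[[[a' b'] c'] d'] e'] [St []]] := clS _ (nbhsx_ballx (a, b, c, d, e) eps eps0).
  move=> [[[aa' bb'] cc'] dd'] ee'.
  by exists a', b', c', d', e'.
move=> /nbhs_ballP[eps /= eps0 epsB].
have [a' [b' [c' [d' [e' [St [[aa' bb' cc'] [dd' ee']]]]]]]] := h _ eps0.
by exists (a', b', c', d', e'); split => //; apply: epsB; split => //.
Qed.

(** Compactness of a segment, phrased with arbitrarily late terms so that no subsequence is
    extracted. *)
Lemma bounded_sequence_cluster (r_ : nat -> R) (m M : R) :
  (forall n, (m <= r_ n <= M)%R) ->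
  exists c : R, forall (eps : R) (N : nat), (0 < eps)%R ->
    exists n, (N <= n)%N /\ (`|c - r_ n| < eps)%R.
Proof.
move=> rmM; have := @segment_compact R m M (r_ n @[n --> \oo]) _.
case; first by exists 0%N => // n _; rewrite /= in_itv/=; exact: rmM.
move=> c [_ clc]; exists c => eps N eps0.
have FN : (r_ n @[n --> \oo]) [set r_ n | n in [set n | (N <= n)%N]].
  by exists N => // n Nn; exists n.
by have [_ [[n Nn <-] cn]] := clc _ _ FN (nbhsx_ballx c eps eps0); exists n.
Qed.

End closure_rd_tuple.

(** * Informations are determined by the laws *)

Section entropy_ext.
Context {R : realType}.

(** Laws obtained in different ways agree on measurable sets without being the same function, so the
    two entropies are compared through a common density. *)
Lemma relative_entropy_ext d (T : measurableType d) (P P' Q Q' : probability T R) :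
  (forall E, measurable E -> P E = P' E) -> (forall E, measurable E -> Q E = Q' E) ->
  relative_entropy P Q = relative_entropy P' Q'.
Proof.
move=> PP' QQ'.
have dom : P `<< Q <-> P' `<< Q'.
  split=> /null_content_dominatesP h; apply/null_content_dominatesP => E mE.
    by move=> E0; rewrite -[LHS]PP'//; apply: h => //; rewrite [LHS]QQ'.
  by move=> E0; rewrite [LHS]PP'//; apply: h => //; rewrite -[LHS]QQ'.
have [PQ|nPQ] := pselect (P `<< Q); last first.
  by rewrite /relative_entropy !asboolF//; apply: contra_not nPQ => /dom.
pose r := Radon_Nikodym_SigmaFinite.f P Q.
have r0 x : 0 <= r x by exact: Radon_Nikodym_SigmaFinite.f_ge0.
have rfin x : r x \is a fin_num by exact: Radon_Nikodym_SigmaFinite.f_fin_num.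
have mr : measurable_fun setT r.
  exact: measurable_int (Radon_Nikodym_SigmaFinite.f_integrable PQ).
pose g x := fine (r x).
have mg : measurable_fun setT g by exact: measurableT_comp.
have g0 x : (0 <= g x)%R by exact: fine_ge0.
have PE E : measurable E -> P E = \int[Q]_(x in E) (g x)%:E.
  move=> mE; rewrite (Radon_Nikodym_SigmaFinite.f_integral PQ)//.
  by apply: eq_integral => x _; rewrite fineK.
rewrite (relative_entropyE mg g0 PE) (@relative_entropyE _ _ _ P' Q' g)//.
  by apply: eq_measure_integral => E mE _; exact: PP'.
move=> E mE; rewrite -PP'// PE//.
by apply: eq_measure_integral => F mF _; exact: QQ'.
Qed.

(** The sample spaces may differ: this compares a law of all five variables with the law of a
    channel. *)
Lemma mutual_info_ext d d' da db (W : measurableType d) (W' : measurableType d')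
    (A : measurableType da) (B : measurableType db) (P : probability W R)
    (P' : probability W' R) (f : {RV P >-> A}) (g : {RV P >-> B})
    (f' : {RV P' >-> A}) (g' : {RV P' >-> B}) :
  (forall E, measurable E ->
    distribution P (rv_pair f g) E = distribution P' (rv_pair f' g') E) ->
  mutual_info f g = mutual_info f' g'.
Proof.
move=> h; apply: (@relative_entropy_ext _ _ _ _ (distribution P f \x distribution P g : probability _ R)
  (distribution P' f' \x distribution P' g' : probability _ R)) => // E mE.
have hf d0 (W0 : measurableType d0) (P0 : probability W0 R) (f0 : {mfun W0 >-> A})
    (g0 : {mfun W0 >-> B}) F : distribution P0 (rv_pair f0 g0) (F `*` setT) = distribution P0 f0 F.
  by rewrite /distribution /pushforward; congr (P0 _); apply/seteqP; split => w //= [].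
have hg d0 (W0 : measurableType d0) (P0 : probability W0 R) (f0 : {mfun W0 >-> A})
    (g0 : {mfun W0 >-> B}) F : distribution P0 (rv_pair f0 g0) (setT `*` F) = distribution P0 g0 F.
  by rewrite /distribution /pushforward; congr (P0 _); apply/seteqP; split => w //= [].
apply: product_measure_ext => // F mF.
  by have := h _ (measurableX mF measurableT); rewrite !hf.
by have := h _ (measurableX measurableT mF); rewrite !hg.
Qed.

End entropy_ext.

(** * Common information and the Pangloss plane *)

Section common_information_theory.
Context {R : realType}.
Context {dx dy dxh dyh : measure_display}.
Context {X : measurableType dx} {Y : measurableType dy}
  {Xh : measurableType dxh} {Yh : measurableType dyh}.
Variables (PXY : probability (X * Y)%type R) (dX : X * Xh -> R) (dY : Y * Yh -> R).
Hypotheses (dX_meas : measurable_fun setT dX) (dX_ge0 : forall z, (0 <= dX z)%R).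
Hypotheses (dY_meas : measurable_fun setT dY) (dY_ge0 : forall z, (0 <= dY z)%R).
Hypothesis hGW : gray_wyner_characterization PXY dX dY.

Let RD := rate_distortion PXY dX dY.
Let mdX : measurable_fun setT (EFin \o dX). Proof. exact/measurable_EFinP. Qed.
Let mdY : measurable_fun setT (EFin \o dY). Proof. exact/measurable_EFinP. Qed.

Lemma rate_distortion_ge0 D1 D2 : 0 <= RD D1 D2.
Proof. by apply: le_ereal_inf_tmp => v [k [J [_ _ ->]]]; exact: mutual_info_ge0. Qed.

Lemma gray_wyner_region_ge0 D1 D2 R0 R1 R2 :
  gray_wyner_region PXY dX dY D1 D2 (R0, R1, R2) -> (0 <= R1)%R /\ (0 <= R2)%R.
Proof.
rewrite /gray_wyner_region/= hGW => /closure_rd_tupleP clS.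
split; rewrite leNgt; apply/negP => Rlt0.
  (* A tuple closer than -R1 would have a negative second rate, whereas single-letter rates are
     bounded below by a conditional information. *)
  have [|a [b [c [d [e [[du [U [P [_ _ _ bP _]]]]]]]]]] := clS (- R1)%R; first by rewrite oppr_gt0.
  move=> [[_ + _] _]; have := le_trans (cond_mutual_info_ge0 _ _ _) bP.
  rewrite lee_fin => b0; rewrite ltr_norml => /andP[+ _]; lra.
have [|a [b [c [d [e [[du [U [P [_ _ _ _ cP]]]]]]]]]] := clS (- R2)%R; first by rewrite oppr_gt0.
move=> [[_ _ +] _]; have := le_trans (cond_mutual_info_ge0 _ _ _) cP.
rewrite lee_fin => c0; rewrite ltr_norml => /andP[+ _]; lra.
Qed.

Lemma gray_wyner_region_up D1 D2 R0 R1 R2 R2' : (R2 <= R2')%R ->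
  gray_wyner_region PXY dX dY D1 D2 (R0, R1, R2) ->
  gray_wyner_region PXY dX dY D1 D2 (R0, R1, R2').
Proof.
move=> le2; rewrite /gray_wyner_region/= hGW => /closure_rd_tupleP clS.
apply/closure_rd_tupleP => eps eps0.
have [a [b [c [d [e [[du [U [P [h1 h2 h3 h4 h5]]]] [[h6 h7 h8] h9]]]]]]] := clS eps eps0.
(* Shifting the approximating tuple by the same amount keeps its distance to the target and only
   relaxes the constraint on its third rate. *)
exists a, b, (c + (R2' - R2))%R, d, e; split.
  exists du, U, P; split => //; rewrite (le_trans h5)// lee_fin lerDl subr_ge0//.
split=> //; split => //.
by rewrite (_ : R2' - (c + (R2' - R2)) = R2 - c)%R//; ring.
Qed.

Lemma gray_wyner_region_closed D1 D2 R0 R1 R2 :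
  (forall eps : R, (0 < eps)%R -> exists R1' R2' : R,
    gray_wyner_region PXY dX dY D1 D2 (R0, R1', R2') /\
    (`|R1 - R1'| < eps /\ `|R2 - R2'| < eps)%R) ->
  gray_wyner_region PXY dX dY D1 D2 (R0, R1, R2).
Proof.
rewrite /gray_wyner_region/= hGW => h; apply/closure_rd_tupleP => eps eps0.
have e20 : (0 < eps / 2)%R by rewrite divr_gt0.
have [R1' [R2' [/closure_rd_tupleP clS [h1 h2]]]] := h _ e20.
have [a [b [c [d [e [Sa [[h3 h4 h5] [h6 h7]]]]]]]] := clS _ e20.
exists a, b, c, d, e; split=> //.
have e2 : (eps / 2 < eps)%R by rewrite ltr_pdivrMr// ltr_pMr// ltr1n.
have tri (x y z : R) : (`|x - y| < eps / 2 -> `|y - z| < eps / 2 -> `|x - z| < eps)%R.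
  move=> xy yz; rewrite (_ : x - z = (x - y) + (y - z))%R; last by ring.
  by rewrite (le_lt_trans (ler_normD _ _))// (splitr eps) ltrD.
split; last by split; exact: lt_trans e2.
by split; [exact: lt_trans e2|exact: tri h4|exact: tri h5].
Qed.

(** Take points of excess at most 1/(n+1), let R1 be a cluster point of their second rates, and let
    the equation of the plane define R2. *)
Lemma pangloss_point D1 D2 R0 : RD D1 D2 < +oo ->
  common_info_rates PXY dX dY D1 D2 R0 ->
  exists R1 R2 : R, gray_wyner_region PXY dX dY D1 D2 (R0, R1, R2) /\
    (R0 + R1 + R2)%:E = RD D1 D2.
Proof.
move=> RDoo R0P.
have RDfin : RD D1 D2 \is a fin_num by rewrite ge0_fin_numE// rate_distortion_ge0.
pose s := fine (RD D1 D2); have sE : RD D1 D2 = s%:E by rewrite fineK.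
pose e_ (n : nat) : R := (n.+1%:R^-1)%R.
have e0 n : (0 < e_ n)%R by rewrite invr_gt0.
have /choice[r_ rP] : forall n, exists r1 : R, exists R2 : R,
    gray_wyner_region PXY dX dY D1 D2 (R0, r1, R2) /\ (R0 + r1 + R2 <= s + e_ n)%R.
  move=> n; have [R1 [R2 [h1 h2]]] := R0P (e_ n) (e0 n).
  by exists R1, R2; split => //; move: h2; rewrite -/RD sE -EFinD lee_fin.
have e1 n : (e_ n <= 1)%R by rewrite invf_le1// ler1n.
(* The upper bound uses that the third rate is nonnegative and the excess at most 1. *)
have rb n : (0 <= r_ n <= s + 1 - R0)%R.
  have [R2 [h1 h2]] := rP n; have [h3 h4] := gray_wyner_region_ge0 h1.
  by rewrite h3/=; have := e1 n; lra.
have [c cP] := bounded_sequence_cluster rb.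
exists c, (s - R0 - c)%R; split; last first.
  by rewrite sE; congr EFin; ring.
apply: gray_wyner_region_closed => eps eps0.
have e20 : (0 < eps / 2)%R by rewrite divr_gt0.
have [N Ne] : exists N, forall n, (N <= n)%N -> (e_ n < eps / 2)%R.
  have [N _ Ne] := near_infty_natSinv_lt (PosNum e20).
  by exists N => n Nn; exact: Ne.
have [n [Nn cn]] := cP _ N e20.
have [R2 [h1 h2]] := rP n.
(* The third rate is raised until the sum is exactly s + e_n, which ties it to [r_ n] and brings it
   close to s - R0 - c. *)
exists (r_ n), (s + e_ n - R0 - r_ n)%R; split.
  by apply: gray_wyner_region_up h1; lra.
split; first by rewrite (lt_le_trans cn)//; lra.
rewrite (_ : s - R0 - c - (s + e_ n - R0 - r_ n) = - (c - r_ n) - e_ n)%R; last by ring.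
rewrite (le_lt_trans (ler_normB _ _))// normrN (gtr0_norm (e0 n)).
by have := Ne n Nn; lra.
Qed.

(** Both laws are the source law followed by the channel [k], hence agree on boxes. *)
Lemma channel_joint_law du (U : measurableType du)
    (P : probability (X * Y * U * Xh * Yh)%type R) k J :
  extends_source P PXY -> channel_law PXY k J ->
  cond_distribution (rvXY P) (rvXhYh P) k ->
  forall E, measurable E ->
    distribution P (rv_pair (rvXY P) (rvXhYh P)) E = J E.
Proof.
move=> Psrc [Jsrc Jk] Pk; apply: box2_unique.
  by rewrite [X in X < _]probability_setT ltry.
move=> E F mE mF; have mkF : measurable_fun setT (fun a => k a F) by exact: measurable_kernel.
transitivity (\int[PXY]_(a in E) k a F).
  transitivity (P (rvXY P @^-1` E `&` rvXhYh P @^-1` F)) => //.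
  rewrite Pk//; transitivity (\int[distribution P (rvXY P)]_(a in E) k a F).
    by rewrite [RHS]ge0_integral_pushforward//; exact: measurable_funTS.
  by apply: eq_measure_integral => G mG _; exact: Psrc.
transitivity (\int[distribution J fst]_(a in E) k a F).
  by apply: eq_measure_integral => G mG _; apply/esym; exact: Jsrc.
rewrite ge0_integral_pushforward//; last exact: measurable_funTS.
rewrite -[LHS]Jk//; congr (J _).
Qed.

Lemma meets_distortionsE du (U : measurableType du)
    (P : probability (X * Y * U * Xh * Yh)%type R)
    (J : probability ((X * Y) * (Xh * Yh))%type R) D1 D2 :
  (forall E, measurable E ->
    distribution P (rv_pair (rvXY P) (rvXhYh P)) E = J E) ->
  meets_distortions dX dY D1 D2 J <-> distortions_le P dX dY D1 D2.
Proof.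
move=> PJ.
have h (f : (X * Y) * (Xh * Yh) -> \bar R) : measurable_fun setT f -> (forall z, 0 <= f z) ->
    \int[J]_z f z = \int[P]_w f (rvXY P w, rvXhYh P w).
  move=> mf f0; transitivity (\int[distribution P (rv_pair (rvXY P) (rvXhYh P))]_z f z).
    by apply: eq_measure_integral => E mE _; apply/esym; exact: PJ.
  by rewrite ge0_integral_pushforward.
rewrite /meets_distortions /distortions_le !unlock/=.
rewrite (h (fun w => (dX (w.1.1, w.2.1))%:E)); last 2 first.
- by apply: (measurableT_comp mdX); measurable_proj.
- by move=> z; rewrite lee_fin.
rewrite (h (fun w => (dY (w.1.2, w.2.2))%:E)); last 2 first.
- by apply: (measurableT_comp mdY); measurable_proj.
- by move=> z; rewrite lee_fin.
by [].
Qed.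

Lemma lossy_common_info_le D1 D2 v : RD D1 D2 < +oo ->
  markov_informations PXY dX dY D1 D2 v -> lossy_common_info PXY dX dY D1 D2 <= v.
Proof.
move=> RDoo [du [U [P [[Psrc dP M1 M2 [k [J [kJ JD JR]] Pk]] ->]]]].
have PJ := channel_joint_law Psrc kJ Pk.
have IE : mutual_info (rvXY P) (rvXhYh P) = RD D1 D2.
  by rewrite -[RHS]JR; apply: mutual_info_ext => E mE; rewrite PJ//; congr (J _); apply/seteqP; split => -[].
have := markov_Gray_Wyner_sum_le dP M1 M2; rewrite IE /Gray_Wyner_sum.
have : 0 <= mutual_info (rvXY P) (rvU P) by exact: mutual_info_ge0.
have : 0 <= cond_mutual_info (rvX P) (rvXh P) (rvU P) by exact: cond_mutual_info_ge0.
have : 0 <= cond_mutual_info (rvY P) (rvYh P) (rvU P) by exact: cond_mutual_info_ge0.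
have : 0 <= RD D1 D2 by exact: rate_distortion_ge0.
have [s sE] : exists s, RD D1 D2 = s%:E.
  by exists (fine (RD D1 D2)); rewrite fineK// ge0_fin_numE// rate_distortion_ge0.
rewrite sE.
(* Nonnegative terms with a finite bound on their sum: every infinite case is contradictory. *)
case E0 : (mutual_info (rvXY P) (rvU P)) => [i0||]//;
  case E1 : (cond_mutual_info (rvX P) (rvXh P) (rvU P)) => [i1||]//;
  case E2 : (cond_mutual_info (rvY P) (rvYh P) (rvU P)) => [i2||]//.
rewrite -!EFinD !lee_fin => s0 i20 i10 i00 sum_le.
(* The three informations form a single-letter point with sum at most the rate-distortion function,
   so one point serves every [eps]. *)
apply: ereal_inf_lbound; exists i0 => // eps eps0; exists i1, i2; split; last first.
  by rewrite -/RD sE -EFinD lee_fin; lra.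
rewrite /gray_wyner_region/= hGW; apply: subset_closure.
exists du, U, P; split => //.
- exact/(meets_distortionsE _ _ PJ).
- by rewrite E0.
- by rewrite E1.
- by rewrite E2.
Qed.

(** The joint density supplies the regular conditional distribution that makes [Q] a competitor in
    the rate-distortion infimum. *)
Lemma induced_channel du (U : measurableType du)
    (Q : probability (X * Y * U * Xh * Yh)%type R) D1 D2 :
  has_joint_density Q -> extends_source Q PXY -> distortions_le Q dX dY D1 D2 ->
  exists (k : R.-pker (X * Y) ~> (Xh * Yh)%type) J,
  [/\ channel_law PXY k J, meets_distortions dX dY D1 D2 J,
      channel_info J = mutual_info (rvXY Q) (rvXhYh Q) &
      cond_distribution (rvXY Q) (rvXhYh Q) k].
Proof.
move=> dQ Qsrc QD; have [Qref _] := joint_density_dominated dQ.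
have [q Hq] := density_XhYh_given_XY Qref.
have [k [_ Hk]] := conditional_density_kernel Hq.
exists k, (distribution Q (rv_pair (rvXY Q) (rvXhYh Q)) : probability _ R); split.
- split=> [E mE|E F mE mF]; first exact: Qsrc.
  transitivity (\int[Q]_(w in rvXY Q @^-1` E) k (rvXY Q w) F); first exact: Hk.
  apply/esym/(@ge0_integral_pushforward _ _ _ _ _ _ (measurable_funP _) _ (fst @^-1` E)
    (fun z : (X * Y) * (Xh * Yh) => k z.1 F)).
  - by rewrite -[X in measurable X]setTI; exact: measurable_fst.
  - apply: measurable_funTS.
    apply: (@measurableT_comp _ _ _ _ _ _ (k ^~ F) _ fst); last exact: measurable_fst.
    exact: measurable_kernel.
  - by move=> z _; exact: measure_ge0.
- apply/(meets_distortionsE (P := Q)); last exact: QD.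
  by move=> E mE.
- apply: mutual_info_ext => E mE; rewrite /distribution /pushforward.
  by congr (Q _); apply/seteqP; split => w.
- exact: Hk.
Qed.

Hypothesis hplane : pangloss_representable PXY dX dY.

Lemma le_lossy_common_info D1 D2 : RD D1 D2 < +oo ->
  ereal_inf (markov_informations PXY dX dY D1 D2) <= lossy_common_info PXY dX dY D1 D2.
Proof.
move=> RDoo; apply: le_ereal_inf_tmp => _ [R0 R0P <-].
have [R1 [R2 [reg RE]]] := pangloss_point RDoo R0P.
have [du [U [P [[Psrc dP PD] [I0 I1 I2]]]]] := hplane reg RE.
have [Q [[dQ QXYU QX QY] [[J0 J1 J2] [le_sum sum_eq]]]] := Gray_Wyner_sum_split dP.
have sumE : Gray_Wyner_sum Q = RD D1 D2.
  by rewrite /Gray_Wyner_sum J0 J1 J2 -I0 -I1 -I2 -!EFinD RE.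
have Qsrc : extends_source Q PXY.
  move=> E mE; rewrite -(Psrc E mE).
  apply: (@law_of_integral _ _ _ _ _ P Q (rvXY P)); last exact: mE.
  move=> h mh h0; apply: (QXYU (fun z => h z.1)); last by move=> z; exact: h0.
  exact: (measurableT_comp mh measurable_fst).
have QD : distortions_le Q dX dY D1 D2.
  move: PD; rewrite /distortions_le !unlock => -[PD1 PD2]; split.
    apply: le_trans PD1; rewrite le_eqVlt; apply/orP; left; apply/eqP.
    apply: (QX (fun z => (dX (z.1.1, z.2))%:E)); last by move=> z; rewrite lee_fin.
    by apply: (measurableT_comp mdX); measurable_proj.
  apply: le_trans PD2; rewrite le_eqVlt; apply/orP; left; apply/eqP.
  apply: (QY (fun z => (dY (z.1.1, z.2))%:E)); last by move=> z; rewrite lee_fin.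
  by apply: (measurableT_comp mdY); measurable_proj.
have [k [J [kJ JD JE Hk]]] := induced_channel dQ Qsrc QD.
(* One inequality is [le_sum]; the other holds because the channel of [Q] meets the distortions, so
   its information is at least the rate-distortion function. The equality also shows that this
   channel is optimal. *)
have IE : Gray_Wyner_sum Q = mutual_info (rvXY Q) (rvXhYh Q).
  apply/eqP; rewrite eq_le le_sum andbT sumE -JE.
  apply: ereal_inf_lbound; exists k, J.
  by split; [exact: kJ|exact: JD|].
have [M1 M2] : markov_chain (rvXh Q) (rvU Q) (rvYh Q) /\ markov_chain (rvXY Q) (rvXhYh Q) (rvU Q).
  by apply: (sum_eq IE); rewrite sumE -RE.
apply: ereal_inf_lbound; exists du, U, Q; split; last by rewrite J0.
split; [exact: Qsrc|exact: dQ|exact: M1|exact: M2|exists k; last exact: Hk].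
by exists J; split; [exact: kJ|exact: JD|rewrite JE -IE].
Qed.

End common_information_theory.

Theorem theorem1 (R : realType) (dx dy dxh dyh : measure_display)
    (X : measurableType dx) (Y : measurableType dy)
    (Xh : measurableType dxh) (Yh : measurableType dyh)
    (PXY : probability (X * Y)%type R)
    (dX : X * Xh -> R) (dY : Y * Yh -> R)
    (hdep : dependent PXY)
    (dX_meas : measurable_fun setT dX) (dX_ge0 : forall z, (0 <= dX z)%R)
    (dY_meas : measurable_fun setT dY) (dY_ge0 : forall z, (0 <= dY z)%R)
    (hGW : gray_wyner_characterization PXY dX dY)
    (hplane : pangloss_representable PXY dX dY) :
  forall D1 D2 : R, rate_distortion PXY dX dY D1 D2 < +oo ->
    lossy_common_info PXY dX dY D1 D2 =
    ereal_inf (markov_informations PXY dX dY D1 D2).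
Proof.
move=> D1 D2 RDoo; apply/eqP; rewrite eq_le; apply/andP; split.
  by apply: le_ereal_inf_tmp => v; exact: lossy_common_info_le.
exact: le_lossy_common_info.
Qed.
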